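(* Let $(\Omega,\mathcal F,P)$ be a probability space with a filtration $(\mathcal F_t)_{t=0}^T$ such that every set in $\mathcal F_0$ has probability zero or one. For $t=1,\dots,T$, let $K_t:\mathbb R^N\times\mathbb R^M\times\mathbb R^N\times\Omega\to\overline{\mathbb R}$ be an $\mathcal F_t$-measurable lower bounded convex normal integrand and let $J:\mathbb R^N\times\Omega\to\overline{\mathbb R}$ be an $\mathcal F_T$-measurable lower bounded convex normal integrand. Consider the problem $$(\mathrm P)\quad\text{minimize } E\Big[\sum_{t=1}^TK_t(X_{t-1},U_{t-1},X_t)+J(X_T)\Big]\ \text{ over } (X,U)\in\mathcal N.$$ Let $((J_t)_{t=0}^T,(\tilde Q_t)_{t=0}^{T-1})$ be a lower bounded convex solution of the reduced Bellman equations $$J_T=J,$$ $$\tilde Q_t(X_t,U_t)=\inf_{X_{t+1}\in\mathbb R^N}\{K_{t+1}(X_t,U_t,X_{t+1})+J_{t+1}(X_{t+1})\},\qquad J_t(X_t)=\inf_{U_t\in\mathbb R^M}(E_t\tilde Q_t)(X_t,U_t),\qquad t=0,\dots,T-1.$$ Then, for all $s=0,\dots,T$, the optimum value of (P) equals that of $$\text{minimize } E\Big[\sum_{t=1}^sK_t(X_{t-1},U_{t-1},X_t)+J_s(X_s)\Big]\ \text{ over } (X,U)\in\mathcal N^s$$ and, moreover, $(\bar X,\bar U)\in\mathcal N$ solves (P) if and only if, almost surely, $\bar X_0\in\operatorname{argmin}_{X_0\in\mathbb R^N}J_0(X_0)$ and, for all $t=0,\dots,T-1$, $$\bar U_t\in\operatorname{argmin}_{U_t\in\mathbb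 R^M}(E_t\tilde Q_t)(\bar X_t,U_t),$$ $$\bar X_{t+1}\in\operatorname{argmin}_{X_{t+1}\in\mathbb R^N}\{K_{t+1}(\bar X_t,\bar U_t,X_{t+1})+J_{t+1}(X_{t+1})\}.$$
   Context: $\overline{\mathbb R}=[-\infty,+\infty]$. A function $h:\mathbb R^n\times\Omega\to\overline{\mathbb R}$ is a ($\mathcal G$-measurable) normal integrand if $\omega\mapsto\operatorname{epi}h(\cdot,\omega)$ is a closed-valued ($\mathcal G$-)measurable set-valued mapping, i.e. $\{\omega\mid \operatorname{epi}h(\cdot,\omega)\cap O\ne\emptyset\}$ is measurable for every open $O\subset\mathbb R^{n}\times\mathbb R$; it is convex if $h(\cdot,\omega)$ is convex for each $\omega$. It is lower bounded if there is $m\in L^1$ with $h(x,\omega)\ge m(\omega)$ for all $x\in\mathbb R^n$ and almost every $\omega$. For a random variable $x$, $h(x)$ denotes $\omega\mapsto h(x(\omega),\omega)$; the argument $\omega$ is often suppressed. For a sub-$\sigma$-algebra $\mathcal G\subset\mathcal F$, the $\mathcal G$-conditional expectation $E^{\mathcal G}h$ of a lower bounded normal integrand $h$ is the ($\mathcal G$-measurable, a.s. unique) normal integrand such that $(E^{\mathcal G}h)(x)=E[h(x)\mid\mathcal G]$ a.s. for every $\mathcal G$-measurable $\mathbb R^n$-valued random variable $x$. $E_t:=E^{\mathcal F_t}$. $\mathcal N$ is the space of adapted processes $(X_t,U_t)_{t=0}^T$, i.e. $(X_t,U_t)$ is $\mathcal F_t$-measurable and $\mathbb R^N\times\mathbb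 R^M$-valued for each $t$ (no integrability is required), and $\mathcal N^s=\{(x_t)_{t=0}^s\mid x\in\mathcal N\}$. A lower bounded convex solution of the reduced Bellman equations consists of lower bounded convex normal integrands $J_t$ on $\mathbb R^N\times\Omega$ and $\tilde Q_t$ on $\mathbb R^N\times\mathbb R^M\times\Omega$ such that, for almost every $\omega$, the equations hold for all $t$ and all $(X_t,U_t)\in\mathbb R^N\times\mathbb R^M$. Conventions: $\operatorname{argmin}f$ is the set of points where $f$ attains its infimum, and is empty if $f\equiv+\infty$; likewise, a solution of a minimization problem is a point attaining the optimum value, the latter being less than $+\infty$. *)

(* Defs.v *)
From HB Require Import structures.
From mathcomp Require Import all_boot all_order all_algebra.
From mathcomp Require Import all_classical all_reals all_analysis.
From mathcomp Require Import measurable_realfun.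

Set Implicit Arguments.
Unset Strict Implicit.
Unset Printing Implicit Defensive.

Import Order.TTheory GRing.Theory Num.Theory.
Import numFieldNormedType.Exports.

Local Open Scope classical_set_scope.
Local Open Scope ring_scope.

(* Integrands are written h : E -> Omega -> \bar R, where E is R^n or a finite
   product of such spaces.  Sub-sigma-algebras of Omega are sets of sets G; it is
   always assumed where it matters that G is a sigma-algebra, so that
   g_sigma_algebraType G has G itself as its measurable sets. *)

Section Integrands.
Context {R : realType} {d : measure_display} {Omega : measurableType d}.
Variable P : probability Omega R.
Implicit Types (G : set (set Omega)) (xi eta : Omega -> \bar R).

Section OneSpace.
Context {E : normedModType R}.
Implicit Types (h g : E -> Omega -> \bar R).

Definition epi (f : E -> \bar R) : set (E * R^o) :=
  [set p | (f p.1 <= (p.2)%:E)%E].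

Definition normal_integrand G h : Prop :=
  (forall w, closed (epi (h^~ w))) /\
  (forall O : set (E * R^o), open O ->
     G [set w | epi (h^~ w) `&` O !=set0]).

(* For extended-real-valued functions convexity is convexity of the epigraph,
   which avoids evaluating +oo - oo. *)
Definition convex_integrand h : Prop := forall w, convex_set (epi (h^~ w)).

Definition lower_bounded h : Prop :=
  exists m : Omega -> R, P.-integrable setT (EFin \o m) /\
    {ae P, forall w, forall x, ((m w)%:E <= h x w)%E}.

Definition lb_convex_normal_integrand G h : Prop :=
  [/\ normal_integrand G h, convex_integrand h & lower_bounded h].

(* G-measurability of an E-valued map for the Borel sigma-algebra of E. *)
Definition random_vector G (x : Omega -> E) : Prop :=
  @measurable_fun _ _ (g_sigma_algebraType G) (g_sigma_algebraType (@open E))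
    setT x.

(* eta is a version of E[xi | G].  It is only used for xi bounded below by an
   integrable function, so that all the integrals are well defined in
   ]-oo, +oo]. *)
Definition is_cond_expectation G xi eta : Prop :=
  @measurable_fun _ _ (g_sigma_algebraType G) (\bar R) setT eta /\
  (forall A, G A -> (\int[P]_(w in A) eta w = \int[P]_(w in A) xi w)%E).

(* g is a version of the conditional expectation E^G h of the integrand h. *)
Definition is_cond_integrand G h g : Prop :=
  normal_integrand G g /\
  (forall x : Omega -> E, random_vector G x ->
     is_cond_expectation G (fun w => h (x w) w) (fun w => g (x w) w)).

Definition argmin (f : E -> \bar R) : set E :=
  [set x | f x = ereal_inf (range f) /\ (f x < +oo)%E].

End OneSpace.

End Integrands.

(* Time runs over nat; only the indices 0, ..., T matter. *)
Section Control.
Context {R : realType} {d : measure_display} {Omega : measurableType d}.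
Variable P : probability Omega R.
Variables (F : nat -> set (set Omega)) (N M : nat).

Definition filtration_upto (T : nat) : Prop :=
  [/\ forall t, (t <= T)%N -> sigma_algebra setT (F t),
      forall t, (t <= T)%N -> F t `<=` measurable &
      forall s t, (s <= t)%N -> (t <= T)%N -> F s `<=` F t].

Definition process := ((nat -> Omega -> 'rV[R]_N) * (nat -> Omega -> 'rV[R]_M))%type.

(* The space N^s (and N itself for s = T). *)
Definition adapted (s : nat) : set process :=
  [set XU | forall t, (t <= s)%N ->
     random_vector (F t) (fun w => (XU.1 t w, XU.2 t w))].

Variable K : nat -> 'rV[R]_N * 'rV[R]_M * 'rV[R]_N -> Omega -> \bar R.

(* The objective of (P) truncated at time s with terminal cost V. *)
Definition cost (s : nat) (V : 'rV[R]_N -> Omega -> \bar R) (XU : process) : \bar R :=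
  (\int[P]_w (\sum_(1 <= t < s.+1)
                K t (XU.1 t.-1 w, XU.2 t.-1 w, XU.1 t w) w
              + V (XU.1 s w) w))%E.

Definition optimum_value (s : nat) (V : 'rV[R]_N -> Omega -> \bar R) : \bar R :=
  ereal_inf [set cost s V XU | XU in adapted s].

Definition is_solution (s : nat) (V : 'rV[R]_N -> Omega -> \bar R) (XU : process) : Prop :=
  [/\ adapted s XU, cost s V XU = optimum_value s V & (optimum_value s V < +oo)%E].

(* EQ stands for a version of the conditional expectations E_t Q_t. *)
Definition reduced_bellman_solution (T : nat) (J : 'rV[R]_N -> Omega -> \bar R)
    (Jt : nat -> 'rV[R]_N -> Omega -> \bar R)
    (Q EQ : nat -> 'rV[R]_N * 'rV[R]_M -> Omega -> \bar R) : Prop :=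
  [/\ forall t, (t <= T)%N -> lb_convex_normal_integrand P measurable (Jt t),
      forall t, (t < T)%N -> lb_convex_normal_integrand P measurable (Q t) &
      {ae P, forall w,
        (forall x, Jt T x w = J x w) /\
        (forall t, (t < T)%N ->
           (forall x u, Q t (x, u) w =
              ereal_inf (range (fun y => (K t.+1 (x, u, y) w + Jt t.+1 y w)%E))) /\
           (forall x, Jt t x w = ereal_inf (range (fun u => EQ t (x, u) w))))}].

End Control.

(* Main.v *)
Require Import Defs.
From HB Require Import structures.
From mathcomp Require Import all_boot all_order all_algebra.
From mathcomp Require Import all_classical all_reals all_analysis.
From mathcomp Require Import measurable_realfun.

Set Implicit Arguments.
Unset Strict Implicit.
Unset Printing Implicit Defensive.

Import Order.TTheory GRing.Theory Num.Theory.
Import numFieldNormedType.Exports.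

Local Open Scope classical_set_scope.
Local Open Scope ring_scope.

(* Write c_s for the expected cost truncated at time s with terminal cost J_s, and
   c'_s for the one with J_s(X_s) replaced by Q_s(X_s, U_s).  Conditioning on F_s
   replaces Q_s by E_s Q_s inside c'_s, so the Bellman equations give
   c_s <= c'_s <= c_{s+1} for every adapted process, with equality (when finite)
   exactly when U_s and X_{s+1} minimize pointwise almost surely.  Conversely,
   eps-optimal adapted controls and states are obtained by measurable selection, so
   the optimum values agree for all s; applied at time 0, selection shows that an
   optimal X_0 minimizes J_0 almost surely.  Triviality of F_0 is what makes the
   optimum finite in the sufficiency part: inf J_0 is almost surely bounded above by
   a constant. *)

(** * Separable spaces with compact balls *)

(** Two obstacles shape the argument. Costs may be infinite and infima need not be attained.
    Integrals are therefore split and compared only for functions with an integrable minorant, and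
    near-minimizers are selected from the lowest nonempty sublevel set on a grid of mesh eps, which
    does not require the infimum itself to be measurable. Moreover, J_{s+1} is given as measurable
    only for the full sigma-algebra, while X_{s+1} must be F_{s+1}-measurable. For s+1 < T, the
    state X_{s+1} is thus selected jointly with an auxiliary control, as a near-minimizer of K_{s+1}
    + E_{s+1} Q_{s+1}. The auxiliary control may be discarded at the next step, because
    J_{s+1}(X_{s+1}) does not depend on it. Selection is developed over an arbitrary measurable
    space, without completeness, so that it applies with F_t as the sigma-algebra. *)

Section ProperSpaces.
Context {R : realType}.

Definition separable_space (E : normedModType R) :=
  exists q : nat -> E, forall z e, 0 < e -> exists k, `|z - q k| < e.

Definition proper_space (E : normedModType R) :=
  forall (z : E) r, compact (closed_ball_ Num.norm z r).

Lemma separable_rV n : separable_space 'rV[R]_n.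
Proof.
exists (fun k => if unpickle k is Some v then map_mx ratr (v : 'rV[rat]_n) else 0).
move=> z e e0.
have rat_close (a : R) : exists p : rat, `|a - ratr p| < e.
  have := @dense_rat R (ball a e) (ex_intro _ a (ballxx a e0)) (ball_open a e).
  by move=> [v [+ [p _ pv]]]; rewrite -pv -ball_normE /= => ?; exists p.
have /choice [p hp] := fun i => rat_close (z ord0 i).
exists (pickle (\row_i p i : 'rV[rat]_n)); rewrite pickleK.
have : ball z e (map_mx ratr (\row_i p i) : 'rV[R]_n).
  split=> // i j; rewrite !mxE ord1 -ball_normE /=; exact: hp.
by rewrite -ball_normE.
Qed.

Lemma separable_R : separable_space R^o.
Proof.
exists (fun k => if unpickle k is Some v then ratr (v : rat) : R else 0).
move=> z e e0.
have := @dense_rat R (ball (z : R) e) (ex_intro _ _ (ballxx _ e0)) (ball_open _ e).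
move=> [v [+ [p _ pv]]]; rewrite -pv -ball_normE /= => ?.
by exists (pickle p); rewrite pickleK.
Qed.

Lemma separable_prod (E F : normedModType R) :
  separable_space E -> separable_space F -> separable_space (E * F)%type.
Proof.
move=> [p hp] [q hq].
exists (fun k => if unpickle k is Some (i, j) then (p i, q j) else 0).
move=> [x y] e e0; have [i hi] := hp x e e0; have [j hj] := hq y e e0.
by exists (pickle (i, j)); rewrite pickleK prod_normE /= gt_max hi hj.
Qed.

Lemma proper_rV n : proper_space 'rV[R]_n.
Proof.
move=> z r; apply: bounded_closed_compact; last exact: closed_closed_ball_.
exists (`|z| + r); split; first exact: num_real.
move=> M hM y /= yr; apply/ltW/(le_lt_trans _ hM).
have -> : y = z - (z - y) by rewrite opprB addrC subrK.
by rewrite (le_trans (ler_normB _ _))// lerD2l.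
Qed.

Lemma proper_prod (E F : normedModType R) :
  proper_space E -> proper_space F -> proper_space (E * F)%type.
Proof.
move=> hE hF [x y] r.
rewrite (_ : closed_ball_ _ _ _ = closed_ball_ Num.norm x r `*` closed_ball_ Num.norm y r).
  exact: compact_setX.
apply/seteqP; split=> -[a b]; rewrite /closed_ball_ /= prod_normE /= ge_max.
  by move=> /andP[].
by move=> [-> ->].
Qed.

Definition rad n : R := n.+1%:R^-1.

Lemma rad_gt0 n : 0 < rad n.
Proof. by rewrite invr_gt0. Qed.

(** The balls centred at the [q k] with radii [rad n] form a countable base. A radius below e/2
    suffices, since two points of such a ball are less than e apart. *)
Lemma open_ball_base (E : normedModType R) (q : nat -> E) (O : set E) z :
  (forall z e, 0 < e -> exists k, `|z - q k| < e) -> open O -> O z ->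
  exists kn : nat * nat, ball (q kn.1) (rad kn.2) z /\
     ball (q kn.1) (rad kn.2) `<=` O.
Proof.
move=> hq oO Oz.
have /nbhs_ballP[e /= e0 eO] : nbhs z O by exact: open_nbhs_nbhs.
have [n] := ltr_add_invr (divr_gt0 e0 (ltr0n R 2)); rewrite add0r => hn.
have [k hk] := hq z _ (rad_gt0 n).
exists (k, n); rewrite -!ball_normE /=; split; first by rewrite distrC.
move=> y hy; apply: eO; rewrite -ball_normE /=.
have -> : z - y = (z - q k) + (q k - y) by rewrite addrA subrK.
rewrite (le_lt_trans (ler_normD _ _))// [ltRHS]splitr ltrD//.
  exact: lt_trans hk hn.
exact: lt_trans hy hn.
Qed.

End ProperSpaces.

(** * Random closed sets and measurable selection *)

Section RandomSets.
Context {R : realType} {d : measure_display} {T : measurableType d}.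

(* A random closed set is encoded by writing the complement of its graph as a
   countable union of rectangles, measurable times open.  This form is stable under
   intersections and substitutions, and on compact sets it yields the hitting
   events by extraction of finite subcovers. *)
Definition ropen {E : normedModType R} (A : T -> set E) :=
  exists (N : nat -> set T) (O : nat -> set E),
    [/\ forall k, measurable (N k), forall k, open (O k) &
        forall w z, A w z <-> exists k, N k w /\ O k z].

Definition rclosed {E : normedModType R} (C : T -> set E) :=
  ropen (fun w => ~` C w).

Section OneSpace.
Context {E : normedModType R}.
Implicit Types A C : T -> set E.

Lemma ropen_count (I : countType) (N : I -> set T) (O : I -> set E) A :
  (forall i, measurable (N i)) -> (forall i, open (O i)) ->
  (forall w z, A w z <-> exists i, N i w /\ O i z) -> ropen A.
Proof.
move=> mN oO AE.
exists (fun k => if unpickle k is Some i then N i else set0).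
exists (fun k => if unpickle k is Some i then O i else set0); split.
- by move=> k; case: unpickle => // i.
- by move=> k; case: unpickle => [i|]; [exact: oO|exact: open0].
- move=> w z; rewrite AE; split=> [[i ?]|[k]].
    by exists (pickle i); rewrite pickleK.
  by case: unpickle => [i|] [] // ? ?; exists i.
Qed.

Lemma ropen_bigcup (I : countType) (A : I -> T -> set E) :
  (forall i, ropen (A i)) -> ropen (fun w => \bigcup_i A i w).
Proof.
move=> rA; have /choice[N hN] := rA; have /choice[G hG] := hN.
apply: (@ropen_count (I * nat)%type (fun p => N p.1 p.2) (fun p => G p.1 p.2)).
- by move=> p; case: (hG p.1).
- by move=> p; case: (hG p.1).
- move=> w z; split=> [[i _]|[[i k] /= h]].
    by have [_ _ ->] := hG i; move=> [k ?]; exists (i, k).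
  by exists i => //; have [_ _ ->] := hG i; exists k.
Qed.

Lemma ropen_restrict (D : set T) A : measurable D -> ropen A ->
  ropen (fun w => [set z | D w /\ A w z]).
Proof.
move=> mD [N [G [mN oO AE]]].
exists (fun k => D `&` N k), G; split => //.
  by move=> k; exact: measurableI.
move=> w z; split=> [[Dw /AE[k []]]|[k [[Dw ?] ?]]]; first by exists k.
by split => //; apply/AE; exists k.
Qed.

Lemma ropen_cst (O : set E) : open O -> ropen (fun=> O).
Proof.
move=> oO; exists (fun=> setT), (fun=> O); split=> // w z.
by split=> [?|[k []]//]; exists 0%N.
Qed.

Lemma eq_ropen A A' : (forall w z, A w z <-> A' w z) -> ropen A -> ropen A'.
Proof.
by move=> h [N [G [mN oO AE]]]; exists N, G; split => // w z; rewrite -h.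
Qed.

Lemma rclosedI C C' : rclosed C -> rclosed C' -> rclosed (fun w => C w `&` C' w).
Proof.
move=> rC rC'.
have := @ropen_bigcup bool (fun b w => if b then ~` C w else ~` C' w).
move=> /(_ _)/eq_ropen; apply; last by case.
move=> w z; rewrite setCI; split=> [[[] _ h]|[h|h]]; [by left|by right| |].
  by exists true.
by exists false.
Qed.

Lemma rclosed_closed C w : rclosed C -> closed (C w).
Proof.
move=> [N [G [mN oO CE]]]; rewrite -openC.
rewrite (_ : ~` C w = \bigcup_(k in [set k | N k w]) G k).
  by apply: bigcup_open.
by apply/seteqP; split=> z => [/CE[k []]|[k /= ? ?]]; [exists k|apply/CE; exists k].
Qed.

(** [C w] misses [B] exactly when finitely many of the open sets active at [w] cover [B], and there
    are only countably many finite index sequences. *)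
Lemma rclosed_hit C (B : set E) : rclosed C -> compact B ->
  measurable [set w | (C w `&` B) !=set0].
Proof.
move=> [N [G [mN oO CE]]] cB.
rewrite -(setCK [set w | _]); apply: measurableC.
pose D (s : seq nat) := [set w : T |
  B `<=` \bigcup_(k in [set` s]) G k /\ (\bigcap_(k in [set` s]) N k) w].
rewrite (_ : ~` _ = \bigcup_s D s); last first.
  apply/seteqP; split=> w.
    move=> /= CB0; move: cB; rewrite compact_cover.
    move=> /(_ _ [set k | N k w] G (fun i _ => oO i)) [].
      move=> z Bz; apply: contrapT => nz; apply: CB0; exists z; split=> //.
      by apply: contrapT => /CE[k []] ? ?; apply: nz; exists k.
    move=> D' D'N; have /finite_seqP[s D's] := finite_fset D'.
    rewrite D's => BO; exists s => //; split=> // k; rewrite -D's => D'k.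
    by have := D'N _ D'k; rewrite in_setE.
  move=> [s _ [BO hN]] [z [Cz Bz]].
  have [k sk Gk] := BO _ Bz.
  by have /(_ Cz) : ~ C w z by apply/CE; exists k; split => //; exact: hN.
apply: countable_bigcupT_measurable => // s.
(* Whether [s] covers [B] does not depend on [w], so [D s] is either a finite intersection of
   measurable events or empty. *)
have [h|h] := pselect (B `<=` \bigcup_(k in [set` s]) G k).
  rewrite (_ : D s = \bigcap_(k in [set` s]) N k).
    by apply: fin_bigcap_measurable.
  by apply/seteqP; split => w; [case|split].
by rewrite (_ : D s = set0)//; apply/seteqP; split => w // [].
Qed.

Lemma rclosed_dom C : proper_space E -> rclosed C ->
  measurable [set w | C w !=set0].
Proof.
move=> pE rC.
rewrite (_ : [set w | _] =
  \bigcup_n [set w | (C w `&` closed_ball_ Num.norm 0 n%:R) !=set0]).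
  by apply: bigcupT_measurable => n; exact: rclosed_hit.
apply/seteqP; split=> w => [[z Cz]|[n _ [z [Cz _]]]]; last by exists z.
exists (Num.truncn `|z|).+1 => //; exists z; split => //.
by rewrite /closed_ball_ /= sub0r normrN ltW// truncnS_gt.
Qed.

End OneSpace.

(** To obtain rectangles again, [x w] is localized in one of countably many basic balls, and [y] is
    kept, with a neighbourhood, among the points that [psi] sends into [G k] together with every
    point of that ball. Continuity of [psi] provides such a ball. *)
Lemma ropen_pull (E E1 E2 : normedModType R) (psi : E1 * E2 -> E) (x : T -> E1)
    (A : T -> set E) :
  separable_space E1 -> continuous psi ->
  (forall O, open O -> measurable (x @^-1` O)) ->
  ropen A -> ropen (fun w => [set y | A w (psi (x w, y))]).
Proof.
move=> [q hq] cpsi mx [N [G [mN oO AE]]].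
pose b p := ball (q p.1) (@rad R p.2).
pose O' (i : nat * (nat * nat)) :=
  interior [set y | forall a, b i.2 a -> G i.1 (psi (a, y))].
apply: (@ropen_count _ _ (fun i : nat * (nat * nat) => N i.1 `&` x @^-1` b i.2) O').
- by move=> i; apply: measurableI => //; apply: mx; exact: ball_open.
- by move=> i; exact: open_interior.
move=> w y /=; rewrite AE; split => [[k [Nk Ok]]|[[k p]] /= [[Nk bx]]]; last first.
  by move=> /interior_subset /(_ _ bx) ?; exists k.
have : nbhs (x w, y) (psi @^-1` G k).
  by apply: cpsi; exact: open_nbhs_nbhs.
move=> [[V W] /= [Vx Wy] VW].
have [p [bx bV]] := open_ball_base hq (@open_interior _ V) Vx.
exists (k, p); split => //; apply: filterS Wy => y' Wy' a /bV /interior_subset Va.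
exact: VW.
Qed.

Section Selection.
Context {E : normedModType R}.
Implicit Types A C : T -> set E.

Lemma rclosed_fixed (C : T -> set E) (x : T -> E) :
  (forall O, open O -> measurable (x @^-1` O)) -> rclosed C ->
  measurable [set w | C w (x w)].
Proof.
move=> mx [N [G [mN oO CE]]].
rewrite -(setCK [set w | _]); apply: measurableC.
rewrite (_ : ~` _ = \bigcup_k (N k `&` x @^-1` G k)).
  by apply: bigcupT_measurable => k; apply: measurableI => //; exact: mx.
apply/seteqP; split=> w => [/CE[k []] ? ?|[k _ [? ?]]]; first by exists k.
by apply/CE; exists k.
Qed.

Lemma measurable_least (P : T -> nat -> Prop) :
  (forall w, exists n, P w n) -> (forall n, measurable [set w | P w n]) ->
  exists k : T -> nat, (forall w, P w (k w)) /\
    forall n, measurable [set w | k w = n].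
Proof.
move=> exP mP.
have least w : exists n, P w n /\ forall m, (m < n)%N -> ~ P w m.
  have exb : exists n, `[<P w n>] by have [n ?] := exP w; exists n; exact/asboolP.
  exists (ex_minn exb); case: ex_minnP => n /asboolP Pn nmin; split=> // m mn Pm.
  by have := nmin m; rewrite leqNgt mn => /(_ (introT (asboolP _) Pm)).
have [k hk] := choice least; exists k; split=> [w|n]; first by case: (hk w).
rewrite (_ : [set w | _] =
    [set w | P w n] `\` \bigcup_(m in `I_n) [set w | P w m]).
  by apply: measurableD => //; apply: bigcup_measurable.
apply/seteqP; split=> w /=.
  by move=> <-; have [? h] := hk w; split=> // -[m /= /h].
move=> [Pn nP]; have [Pk kmin] := hk w.
apply/eqP; rewrite eqn_leq; apply/andP; split; rewrite leqNgt; apply/negP => h.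
  exact: kmin Pn.
by apply: nP; exists (k w).
Qed.

(* Kuratowski--Ryll-Nardzewski, with the approximating balls chosen compact so
   that the nested intersection is nonempty. *)
Lemma measurable_selection C : separable_space E -> proper_space E -> rclosed C ->
  exists x : T -> E, (forall O, open O -> measurable (x @^-1` O)) /\
    forall w, C w !=set0 -> C w (x w).
Proof.
move=> [q hq] pE rC.
(* Where [C w] is empty it is replaced by the whole space; that event is measurable by
   [rclosed_dom], so the new family is still a random closed set. *)
wlog Cne : C rC / forall w, C w !=set0.
  move=> wl; pose C' w := [set z | C w !=set0 -> C w z].
  have [||x [mx Cx]] := wl C'.
  - have := ropen_restrict (rclosed_dom pE rC) rC.
    by apply: eq_ropen => w z; rewrite /C' /setC /=; split => [[h1 h2] /(_ h1)//|/not_implyP].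
  - by move=> w; have [[z Cz]|h] := pselect (C w !=set0); [exists z|exists 0].
  - exists x; split => // w [z Cz]; apply: (Cx w); last by exists z.
    by exists z.
pose cb k n := closed_ball_ Num.norm (q k) (@rad R n).
pose good (S : T -> set E) := rclosed S /\ forall w, S w !=set0.
(* One refinement: [S w] is cut by the first closed ball of radius [rad n] that it meets, [p.2 w]
   being the index of the centre. Putting [good S] under the existential makes the step total, so
   that it can be iterated by choice. *)
have step n S : exists p : (T -> set E) * (T -> nat), good S ->
    [/\ good p.1, forall k, measurable [set w | p.2 w = k] &
        forall w, p.1 w = S w `&` cb (p.2 w) n].
  have [[rS neS]|?] := pselect (good S); last by exists (S, fun=> 0%N).
  have [|k|k [Sk mk]] := @measurable_least (fun w k => (S w `&` cb k n) !=set0).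
  - move=> w; have [z Sz] := neS w; have [k hk] := hq z _ (rad_gt0 n).
    exists k, z; split => //; rewrite /cb /closed_ball_ /= distrC; exact: ltW.
  - by apply: rclosed_hit => //; exact: pE.
  exists (fun w => S w `&` cb (k w) n, k) => _; split => //; split=> //=.
  apply: rclosedI => //.
  have := @ropen_bigcup _ nat (fun i w => [set z | k w = i /\ ~ cb i n z]).
  move=> /(_ _)/eq_ropen; apply.
    by move=> w z; split => [[i _ [<-]]//|h]; exists (k w).
  move=> i; apply: (ropen_restrict (mk i)); apply: ropen_cst.
  by rewrite openC; exact: closed_closed_ball_.
have /choice[st hst] := fun nS : nat * (T -> set E) => step nS.1 nS.2.
pose S := fix S n := if n is m.+1 then (st (m, S m)).1 else C.
pose k n := (st (n, S n)).2.
have gS n : good (S n) by elim: n => [|n IH]; [split|case: (hst (n, S n) IH)].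
have mk n j : measurable [set w | k n w = j].
  by have [_ /(_ j)] := hst (n, S n) (gS n).
have SS n w : S n.+1 w = S n w `&` cb (k n w) n.
  by have [_ _ /(_ w)] := hst (n, S n) (gS n).
have Smono w m n : (m <= n)%N -> S n w `<=` S m w.
  move=> /subnK <-; elim: (n - m)%N => // p IH.
  by rewrite addSn SS; apply: subset_trans IH; exact: subIsetl.
(* The intersection starts at [S 1], the first set contained in a compact ball, so the finite
   intersection property applies. *)
have ne w : (\bigcap_n S n.+1 w) !=set0.
  have : compact (cb (k 0%N w) 0) by exact: pE.
  rewrite compact_In0 => /(_ _ setT (fun n => S n.+1 w)); apply.
    exists (fun n => S n.+1 w) => [n _|n _].
      by apply: rclosed_closed; exact: (gS n.+1).1.
    rewrite eqEsubset; split; last exact: subIsetr.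
    rewrite subsetI; split=> //; apply: subset_trans (Smono w 1%N n.+1 _) _ => //.
    by rewrite SS; exact: subIsetr.
  move=> D' _; have /finite_seqP[s ->] := finite_fset D'.
  have [z Sz] := (gS (\max_(i <- s) i).+1).2 w.
  exists z => i /= si; apply: (Smono w i.+1 _ _ z Sz).
  by rewrite ltnS; exact: (@leq_bigmax_seq _ s xpredT id i si isT).
have /choice[x hx] := ne.
have xk n w : `|q (k n w) - x w| <= rad n.
  by have := hx w n I; rewrite SS => -[].
exists x; split; last by move=> w _; have := hx w 0%N I; rewrite SS => -[].
move=> O oO.
(* [x w] lies in [O] iff, at some stage, the ball chosen around it lies inside [O]; this involves
   only the measurable indices [k n]. *)
rewrite (_ : x @^-1` O = \bigcup_n \bigcup_(j in [set j | cb j n `<=` O])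
    [set w | k n w = j]).
  by apply: bigcupT_measurable => n; apply: bigcup_measurable.
apply/seteqP; split=> w /=.
  move=> Ox; have /nbhs_ballP[e /= e0 eO] : nbhs (x w) O by exact: open_nbhs_nbhs.
  have [n] := ltr_add_invr (divr_gt0 e0 (ltr0n R 2)); rewrite add0r => hn.
  exists n => //; exists (k n w) => // y; rewrite /cb /closed_ball_ /= => hy.
  apply: eO; rewrite -ball_normE /=.
  have -> : x w - y = (x w - q (k n w)) + (q (k n w) - y) by rewrite addrA subrK.
  rewrite (le_lt_trans (ler_normD _ _))// [ltRHS]splitr ltrD//.
    by rewrite distrC (le_lt_trans (xk _ _)).
  exact: le_lt_trans hy _.
by move=> [n _ [j /= jO kj]]; apply: jO; rewrite -kj; exact: xk.
Qed.

(* Selecting from the intersection of all nonempty sets of the family selects,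
   for a monotone family, from the smallest nonempty one. *)
Lemma measurable_level_selection (C : int -> T -> set E) :
  separable_space E -> proper_space E -> (forall i, rclosed (C i)) ->
  (forall i j w, (i <= j)%R -> C i w `<=` C j w) ->
  exists x : T -> E, (forall O, open O -> measurable (x @^-1` O)) /\
    forall w i, C i w !=set0 -> C (i - 1) w = set0 -> C i w (x w).
Proof.
move=> sE pE rC Cmono.
pose D w := [set z | forall i, C i w !=set0 -> C i w z].
have rD : rclosed D.
  have := @ropen_bigcup _ int (fun i w => [set z | C i w !=set0 /\ ~ C i w z]).
  move=> /(_ (fun i => ropen_restrict (rclosed_dom pE (rC i)) (rC i))).
  apply: eq_ropen => w z; rewrite /D /setC /=; split.
    by move=> [i _ [h1 h2]] /(_ i h1).
  by move=> /existsNP[i /not_implyP[? ?]]; exists i.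
have [x [mx Dx]] := measurable_selection sE pE rD.
exists x; split => // w i Ci Ci1; apply: (Dx w _ i Ci).
have [z Cz] := Ci; exists z => j [y Cy]; apply: (Cmono i j w _ z Cz).
rewrite leNgt; apply/negP => ji.
suff : C (i - 1) w y by rewrite Ci1.
by apply: (Cmono j _ w _ y Cy); rewrite -ltzD1 subrK.
Qed.

End Selection.
End RandomSets.

(** * Random lower semicontinuous functions *)

Lemma continuous_pair {E E1 E2 : topologicalType} (f : E -> E1) (g : E -> E2) :
  continuous f -> continuous g -> continuous (fun p => (f p, g p)).
Proof. by move=> cf cg p; exact: (cvg_pair (cf p) (cg p)). Qed.

Lemma continuous_compT {E E1 E2 : topologicalType} (f : E -> E1) (g : E1 -> E2) :
  continuous f -> continuous g -> continuous (fun p => g (f p)).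
Proof. by move=> cf cg p; apply: continuous_comp; [exact: cf|exact: cg]. Qed.

Lemma continuous_fst {E1 E2 : topologicalType} : continuous (fst : E1 * E2 -> E1).
Proof. by move=> p; exact: cvg_fst. Qed.

Lemma continuous_snd {E1 E2 : topologicalType} : continuous (snd : E1 * E2 -> E2).
Proof. by move=> p; exact: cvg_snd. Qed.

Lemma continuous_id {E : topologicalType} : continuous (fun z : E => z).
Proof. by move=> p. Qed.

Section RandomLsc.
Context {R : realType} {d : measure_display} {T : measurableType d}.

Definition borel {E : normedModType R} (x : T -> E) :=
  forall O : set E, open O -> measurable (x @^-1` O).

Definition random_lsc {E : normedModType R} (h : E -> T -> \bar R) :=
  rclosed (fun w => epi (h^~ w)).

Lemma borel_comp (E E' : normedModType R) (phi : E -> E') (x : T -> E) :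
  continuous phi -> borel x -> borel (phi \o x).
Proof.
by move=> cphi bx O oO; rewrite comp_preimage; apply: bx; move/continuousP : cphi; exact.
Qed.

Lemma borel_pair (E E' : normedModType R) (x : T -> E) (y : T -> E') :
  separable_space E -> separable_space E' ->
  borel x -> borel y -> borel (fun w => (x w, y w)).
Proof.
move=> sE sE' bx byy O oO; have [q hq] := separable_prod sE sE'.
pose b p := ball (q p.1) (@rad R p.2).
rewrite (_ : _ @^-1` _ = \bigcup_(p in [set p | b p `<=` O])
    (x @^-1` ball (q p.1).1 (rad p.2) `&` y @^-1` ball (q p.1).2 (rad p.2))).
  rewrite bigcup_mkcond; apply: countable_bigcupT_measurable => // p.
  case: ifP => // _; apply: measurableI; [apply: bx|apply: byy]; exact: ball_open.
apply/seteqP; split => w /=.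
  by move=> /(open_ball_base hq oO)[p [[? ?] ?]]; exists p.
by move=> [p /= pO [? ?]]; exact: pO.
Qed.

Lemma ropenI (E : normedModType R) (A B : T -> set E) :
  ropen A -> ropen B -> ropen (fun w => A w `&` B w).
Proof.
move=> [N [G [mN oG AE]]] [N' [G' [mN' oG' BE]]].
apply: (@ropen_count _ _ _ _ _ (fun p : nat * nat => N p.1 `&` N' p.2)
  (fun p : nat * nat => G p.1 `&` G' p.2)).
- by move=> p; exact: measurableI.
- by move=> p; exact: openI.
- move=> w z; split=> [[/AE[k [? ?]] /BE[l [? ?]]]|]; first by exists (k, l).
  by move=> [[k l] /= [[? ?] [? ?]]]; split; [apply/AE; exists k|apply/BE; exists l].
Qed.

Lemma ropen_comp (E E' : normedModType R) (phi : E' -> E) (A : T -> set E) :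
  continuous phi -> ropen A -> ropen (fun w => phi @^-1` A w).
Proof.
move=> cphi [N [G [mN oG AE]]]; exists N, (fun k => phi @^-1` G k).
split=> [//|k|w z]; last exact: AE.
by move/continuousP : cphi; apply; exact: oG.
Qed.

(* f + g > a iff f > r and g > a - r for some rational r, even at infinite values,
   because -oo absorbs +oo. *)
Lemma random_lsc_add (E : normedModType R) (f g : E -> T -> \bar R) :
  random_lsc f -> random_lsc g -> random_lsc (fun z w => f z w + g z w)%E.
Proof.
move=> rf rg.
have := @ropen_bigcup _ _ _ _ rat (fun r w =>
  (fun p : E * R^o => (p.1, ratr r : R^o)) @^-1` (~` epi (f^~ w)) `&`
  (fun p : E * R^o => (p.1, p.2 - ratr r : R^o)) @^-1` (~` epi (g^~ w))).
move=> /(_ _)/eq_ropen; apply.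
  move=> w [z a]; rewrite /epi; split.
    move=> [r _ [/= /negP + /negP]]; rewrite -!ltNge => fr gr /=.
    apply/negP; rewrite -ltNge; rewrite (_ : a = ratr r + (a - ratr r)).
      by rewrite EFinD; exact: lteD.
    by rewrite addrC subrK.
  move=> /= /negP; rewrite -ltNge => afg.
  have : exists r : rat, ((ratr r)%:E < f z w)%E /\ ((a - ratr r)%:E < g z w)%E.
    case: (f z w) (g z w) afg => [x| |] [y| |] //=.
    - rewrite -EFinD lte_fin -ltrBlDr => /rat_in_itvoo[r].
      by rewrite in_itv /= => /andP[? ?]; exists r; rewrite !lte_fin ltrBlDl -ltrBlDr.
    - move=> _; have /rat_in_itvoo[r] : x - 1 < x by rewrite ltrBlDr ltrDl.
      by rewrite in_itv /= => /andP[? ?]; exists r; rewrite lte_fin ltry.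
    - move=> _; have /rat_in_itvoo[r] : a - y < a - y + 1 by rewrite ltrDl.
      rewrite in_itv /= => /andP[? ?]; exists r; rewrite lte_fin ltry.
      by rewrite ltrBlDl -ltrBlDr.
    - by move=> _; exists 0; rewrite !ltry.
  by move=> [r [fr gr]]; exists r => //; split => /=; apply/negP; rewrite -ltNge.
move=> r; apply: ropenI; apply: ropen_comp => //.
  by apply: continuous_pair; [exact: continuous_fst|exact: cst_continuous].
apply: continuous_pair; first exact: continuous_fst.
by move=> p; apply: cvgB; [exact: cvg_snd|exact: cvg_cst].
Qed.

Lemma random_lsc_pull (E E1 E2 : normedModType R) (psi : E1 * E2 -> E)
    (x : T -> E1) (h : E -> T -> \bar R) :
  separable_space E1 -> continuous psi -> borel x -> random_lsc h ->
  random_lsc (fun y w => h (psi (x w, y)) w).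
Proof.
move=> sE1 cpsi bx rh.
have := @ropen_pull _ _ _ _ _ _
  (fun p : E1 * (E2 * R^o) => (psi (p.1, p.2.1), p.2.2)) x _ sE1 _ bx rh.
move=> /(_ _)/eq_ropen; apply => //.
apply: continuous_pair.
  apply: (@continuous_compT _ _ _ (fun p : E1 * (E2 * R^o) => (p.1, p.2.1)) psi) => //.
  apply: continuous_pair; first exact: continuous_fst.
  by apply: continuous_compT; [exact: continuous_snd|exact: continuous_fst].
by apply: continuous_compT; [exact: continuous_snd|exact: continuous_snd].
Qed.

Lemma random_lsc_comp (E E' : normedModType R) (phi : E' -> E)
    (h : E -> T -> \bar R) :
  continuous phi -> random_lsc h -> random_lsc (fun y w => h (phi y) w).
Proof.
move=> cphi; apply: (@ropen_comp _ _ (fun p : E' * R^o => (phi p.1, p.2))).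
apply: continuous_pair; last exact: continuous_snd.
by apply: continuous_compT; [exact: continuous_fst|exact: cphi].
Qed.

Section OneSpace.
Context {E : normedModType R} (h : E -> T -> \bar R).
Hypothesis rh : random_lsc h.

Lemma random_lsc_level (r : R) : rclosed (fun w => [set z | (h z w <= r%:E)%E]).
Proof.
apply: (@ropen_comp _ _ (fun z : E => (z, r : R^o)) _ _ rh).
by apply: continuous_pair; [exact: continuous_id|exact: cst_continuous].
Qed.

Lemma random_lsc_eval (x : T -> E) : borel x ->
  measurable_fun setT (fun w => h (x w) w).
Proof.
move=> bx mD; apply: (measurability _ (ErealGenOInfty.measurableE R)) => //.
move=> /= _ [_ [a ->]] <-; rewrite setTI.
rewrite (_ : _ @^-1` _ = ~` [set w | (h (x w) w <= a%:E)%E]).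
  by apply: measurableC; exact: rclosed_fixed bx (random_lsc_level a).
apply/seteqP; split=> w; rewrite /= in_itv /= andbT.
  by move=> ?; apply/negP; rewrite -ltNge.
by move=> /negP; rewrite -ltNge.
Qed.

(** Among the sublevel sets at integer multiples of [e], the lowest nonempty one has level at most
    the infimum plus [e], so any selection from it is [e]-optimal. *)
Lemma random_lsc_eps_min (e : R) : separable_space E -> proper_space E -> 0 < e ->
  exists x : T -> E, borel x /\
    forall w, ereal_inf (range (h^~ w)) \is a fin_num ->
      (h (x w) w <= ereal_inf (range (h^~ w)) + e%:E)%E.
Proof.
move=> sE pE e0.
pose C (i : int) w := [set z | (h z w <= (i%:~R * e)%:E)%E].
have [||x [bx Cx]] := @measurable_level_selection _ _ _ _ C sE pE.
- by move=> i; exact: random_lsc_level.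
- move=> i j w ij z /= /le_trans; apply; rewrite lee_fin ler_pM2r// ler_int.
  exact: ij.
exists x; split=> // w; set I := ereal_inf _ => Ifin.
have lbI z : (I <= h z w)%E by apply: ereal_inf_lbound; exists z.
rewrite -(fineK Ifin); set a := fine I.
set j := Num.floor (a / e).
have ja : j%:~R * e <= a by rewrite -ler_pdivlMr// Num.Theory.floor_le.
have aj : a < (j + 1)%:~R * e.
  by rewrite -ltr_pdivrMr// Num.Theory.floorD1_gt.
have emptyC (i : int) : i%:~R * e < a -> C i w = set0.
  move=> ia; apply/seteqP; split => // z /= Ciz.
  have := le_trans (lbI z) Ciz; rewrite -(fineK Ifin) lee_fin -/a.
  by rewrite leNgt ia.
(* The level [j * e] is at most the infimum, so [C j w] is nonempty only if the infimum equals
   [j * e] and is attained; otherwise [j + 1] is the lowest nonempty level. *)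
have [Cj|Cj] := pselect (C j w !=set0).
  have := Cx w j Cj; rewrite emptyC; last first.
    by rewrite (lt_le_trans _ ja)// ltr_pM2r// ltr_int ltrBlDr ltrDl ltr01.
  move=> /(_ erefl) /= /le_trans; apply.
  by rewrite -EFinD lee_fin (le_trans ja)// lerDl ltW.
have Cj1 : C (j + 1) w (x w).
  apply: Cx; last by rewrite addrK; apply/seteqP; split=> // z Cz; apply: Cj; exists z.
  have : (I < ((j + 1)%:~R * e)%:E)%E by rewrite -(fineK Ifin) lte_fin.
  by move=> /ereal_inf_lt[_ [z _ <-]] hz; exists z; exact: ltW.
apply: (le_trans Cj1).
by rewrite -EFinD lee_fin intrD mulrDl mul1r lerD2r.
Qed.

End OneSpace.
End RandomLsc.

(** * Normal integrands as random lower semicontinuous functions *)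

Section Integrands.
Context {R : realType} {d : measure_display} {Omega : measurableType d}.
Implicit Types G : set (set Omega).

(** The complement of a closed epigraph is the union of the basic balls that miss it, and the event
    that a given ball is missed is the complement of a hitting event in [G]. *)
Lemma normal_random_lsc G (E : normedModType R) (h : E -> Omega -> \bar R) :
  separable_space E -> normal_integrand G h ->
  @random_lsc _ _ (g_sigma_algebraType G) _ h.
Proof.
move=> sE [clh mh]; have [q hq] := separable_prod sE separable_R.
pose b p := ball (q p.1) (@rad R p.2).
apply: (@ropen_count _ _ (g_sigma_algebraType G) _ _
  (fun p : nat * nat => ~` [set w | (epi (h^~ w) `&` b p) !=set0]) b).
- move=> p; apply: (@measurableC _ (g_sigma_algebraType G)).
  by apply: sub_sigma_algebra; apply: mh; exact: ball_open.
- by move=> p; exact: ball_open.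
- move=> w z; split=> [|[p [/= hb bz hz]]].
    move=> /(open_ball_base hq (closed_openC (clh w)))[p [bz be]].
    by exists p; split=> // -[y [hy /be]].
  by apply: hb; exists z.
Qed.

Lemma random_vectorP G (E : normedModType R) (x : Omega -> E) :
  random_vector G x <-> @borel _ _ (g_sigma_algebraType G) _ x.
Proof.
split=> [mx O oO|bx].
  by rewrite -[_ @^-1` _]setTI; apply: mx => //; exact: sub_sigma_algebra.
apply: (@measurability _ _ (g_sigma_algebraType G)
  (g_sigma_algebraType (@open E)) _ _ (@open E)) => //.
by move=> _ [V oV <-]; rewrite setTI; exact: bx.
Qed.

End Integrands.

(** * Functions minorized by an integrable function *)

Section QuasiIntegrable.
Context {R : realType} {d : measure_display} {T : measurableType d}.
Variable mu : {measure set T -> \bar R}.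
Local Open Scope ereal_scope.

Definition quasi_integrable (f : T -> \bar R) :=
  measurable_fun setT f /\
  exists m : T -> R, mu.-integrable setT (EFin \o m) /\
    {ae mu, forall w, (m w)%:E <= f w}.

(** The case of interest is an infinite integral of [g]: the negative part of the sum is dominated
    by |m|, while g is at most its positive part plus |m|, so that part has infinite integral. *)
Lemma ge0_integralD_integrable (g : T -> \bar R) (m : T -> R) :
  measurable_fun setT g -> (forall w, 0 <= g w) ->
  mu.-integrable setT (EFin \o m) ->
  \int[mu]_w (g w + (m w)%:E) = \int[mu]_w g w + \int[mu]_w (m w)%:E.
Proof.
move=> mg g0 im; have mm := measurable_int mu im.
have mm' : measurable_fun setT (fun w => (m w)%:E) by [].
have [goo|] := ltP (\int[mu]_w g w) +oo.
  have ig : mu.-integrable setT g.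
    apply/integrableP; split => //.
    by under eq_integral do rewrite gee0_abs//.
  by rewrite -(integralD measurableT ig im).
rewrite leye_eq => /eqP goo; rewrite goo addye; last first.
  by have := integrable_fin_num measurableT im; case: (\int[mu]_w _).
set f := fun w => g w + (m w)%:E.
have mf : measurable_fun setT f by exact: emeasurable_funD.
have abs_lt : \int[mu]_w `|(m w)%:E| < +oo by have /integrableP[] := im.
have mabs : measurable_fun setT (fun w => `|(m w)%:E|) by exact: measurableT_comp.
have negf : \int[mu]_w f^\- w < +oo.
  apply: le_lt_trans abs_lt; apply: ge0_le_integral => //.
    exact: measurable_funeneg.
  move=> w _; rewrite funenegE ge_max abse_ge0 andbT /f.
  move: (g0 w); case: (g w) => [x| |] //=; rewrite ?leNye// !lee_fin => x0.
  by rewrite opprD -[leRHS]normrN (le_trans _ (ler_norm _))// gerDr oppr_le0.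
have posf : \int[mu]_w f^\+ w = +oo.
  apply/eqP; rewrite -leye_eq leNgt; apply/negP => fpos.
  have : \int[mu]_w g w <= \int[mu]_w (f^\+ w + `|(m w)%:E|).
    apply: ge0_le_integral => //.
      by apply: emeasurable_funD => //; exact: measurable_funepos.
    move=> w _; rewrite funeposE /f.
    apply: (@le_trans _ _ (g w + (m w)%:E + `|(m w)%:E|)).
      move: (g0 w); case: (g w) => [x| |] //=; rewrite ?leey// !lee_fin => x0.
      by rewrite -addrA lerDl -lerBlDl sub0r -[leRHS]normrN ler_norm.
    by rewrite leeD2r// le_max lexx.
  rewrite ge0_integralD//; last exact: measurable_funepos.
  by rewrite goo leye_eq => /eqP; apply/eqP; rewrite lt_eqF// lte_add_pinfty.
by rewrite integralE posf addye//; case: (\int[mu]_w f^\- w) negf.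
Qed.

(** The minorant holds only almost everywhere; truncating [f - m] at 0 makes the remainder
    nonnegative everywhere, as integration of nonnegative functions demands. *)
Lemma quasi_integrable_repr f : quasi_integrable f ->
  exists (g : T -> \bar R) (m : T -> R),
    [/\ measurable_fun setT g, forall w, 0 <= g w, mu.-integrable setT (EFin \o m)
      & {ae mu, forall w, f w = g w + (m w)%:E}].
Proof.
move=> [mf [m [im mlef]]]; exists (fun w => maxe (f w - (m w)%:E) 0), m.
have mm := measurable_int mu im.
split => //.
- by apply: measurable_maxe => //; exact: emeasurable_funB.
- by move=> w; rewrite le_max lexx orbT.
- apply: filterS mlef => w mf'; rewrite max_l ?sube_ge0// ?subeK//.
Qed.

Lemma quasi_integrableD f g : quasi_integrable f -> quasi_integrable g ->
  quasi_integrable (fun w => f w + g w).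
Proof.
move=> [mf [m [im mlef]]] [mg [n [jn nleg]]]; split; first exact: emeasurable_funD.
exists (fun w => m w + n w)%R; split.
  by rewrite (_ : _ \o _ = (EFin \o m) \+ (EFin \o n))//; exact: integrableD.
by apply: filterS2 mlef nleg => w ? ?; rewrite EFinD leeD.
Qed.

Lemma ae_eq_integralT f g : measurable_fun setT f -> measurable_fun setT g ->
  {ae mu, forall w, f w = g w} -> \int[mu]_w f w = \int[mu]_w g w.
Proof. by move=> mf mg fg; apply: ae_eq_integral => //; apply: filterS fg. Qed.

Lemma quasi_integralD f g : quasi_integrable f -> quasi_integrable g ->
  \int[mu]_w (f w + g w) = \int[mu]_w f w + \int[mu]_w g w.
Proof.
move=> qf qg; have [mfg _] := quasi_integrableD qf qg.
have [f' [m [mf' f'0 im fE]]] := quasi_integrable_repr qf.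
have [g' [n [mg' g'0 jn gE]]] := quasi_integrable_repr qg.
have [mf _] := qf; have [mg _] := qg.
have mm := measurable_int mu im; have mn := measurable_int mu jn.
have imn : mu.-integrable setT (EFin \o (fun w => m w + n w)%R).
  by rewrite (_ : _ \o _ = (EFin \o m) \+ (EFin \o n))//; exact: integrableD.
have mmn := measurable_int mu imn.
rewrite (@ae_eq_integralT f (fun w => f' w + (m w)%:E))//; last exact: emeasurable_funD.
rewrite (@ae_eq_integralT g (fun w => g' w + (n w)%:E))//; last exact: emeasurable_funD.
rewrite (@ae_eq_integralT (fun w => f w + g w)
  (fun w => (f' w + g' w) + (m w + n w)%:E))//.
- rewrite !ge0_integralD_integrable//.
  + rewrite ge0_integralD// addeACA; congr (_ + _).
    by rewrite -(integralD measurableT im jn).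
  + exact: emeasurable_funD.
  + by move=> w; exact: adde_ge0.
- by apply: emeasurable_funD => //; exact: emeasurable_funD.
- by apply: filterS2 fE gE => w -> ->; rewrite addeACA.
Qed.

Lemma quasi_le f g : quasi_integrable f -> measurable_fun setT g ->
  {ae mu, forall w, f w <= g w} -> quasi_integrable g.
Proof.
move=> [_ [m [im mlef]]] mg fg; split=> //; exists m; split=> //.
by apply: filterS2 mlef fg => w; exact: le_trans.
Qed.

Lemma le_quasi_integral f g : quasi_integrable f -> measurable_fun setT g ->
  {ae mu, forall w, f w <= g w} -> \int[mu]_w f w <= \int[mu]_w g w.
Proof.
move=> qf mg fg.
have [f' [m [mf' f'0 im fE]]] := quasi_integrable_repr qf.
have [mf _] := qf; have mm := measurable_int mu im.
(* The maximum with [f'] turns the almost everywhere inequality into one valid everywhere and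
   changes [g - m] only on a null set. *)
pose g' w := maxe (g w - (m w)%:E) (f' w).
have mg' : measurable_fun setT g'.
  by apply: measurable_maxe => //; exact: emeasurable_funB.
have f'g' w : f' w <= g' w by rewrite le_max lexx orbT.
rewrite (@ae_eq_integralT f (fun w => f' w + (m w)%:E))//; last exact: emeasurable_funD.
rewrite (@ae_eq_integralT g (fun w => g' w + (m w)%:E))//.
- rewrite !ge0_integralD_integrable//; last by move=> w; exact: le_trans (f'g' w).
  by rewrite leeD2r// ge0_le_integral.
- exact: emeasurable_funD.
- apply: filterS2 fE fg => w fE' fg'; rewrite /g' max_l ?subeK//.
  by rewrite leeBrDr// -fE'.
Qed.

Lemma quasi_integrable_integrable f : quasi_integrable f ->
  \int[mu]_w f w < +oo -> mu.-integrable setT f.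
Proof.
move=> qf; have [f' [m [mf' f'0 im fE]]] := quasi_integrable_repr qf.
have [mf _] := qf; have mm := measurable_int mu im.
rewrite (@ae_eq_integralT f (fun w => f' w + (m w)%:E))//; last exact: emeasurable_funD.
rewrite ge0_integralD_integrable// => foo.
have if' : mu.-integrable setT f'.
  apply/integrableP; split => //; under eq_integral do rewrite gee0_abs//.
  have := integrable_fin_num measurableT im.
  rewrite /comp => mfin; rewrite ltey; apply/eqP => f'oo.
  by move: foo; rewrite f'oo addye//; move: mfin; case: (\int[mu]_w _).
have iD := integrableD measurableT if' im.
apply/integrableP; split => //; have /integrableP[_] := iD.
congr (_ < _); apply: ae_eq_integralT.
- by apply: measurableT_comp => //; exact: measurable_int iD.
- exact: measurableT_comp.
- by apply: filterS fE => w ->.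
Qed.

(** Both functions are integrable, and their difference is nonnegative almost everywhere with zero
    integral. Finiteness of the common value is recorded because it later permits cancelling the
    running cost and supplies the bound below +oo in [argmin]. *)
Lemma quasi_integral_ae_eq f g : quasi_integrable f -> measurable_fun setT g ->
  {ae mu, forall w, f w <= g w} ->
  \int[mu]_w g w <= \int[mu]_w f w -> \int[mu]_w g w < +oo ->
  {ae mu, forall w, f w = g w /\ f w \is a fin_num}.
Proof.
move=> qf mg fg gf goo; have qg := quasi_le qf mg fg.
have ig := quasi_integrable_integrable qg goo.
have if_ : mu.-integrable setT f.
  apply: (quasi_integrable_integrable qf).
  exact: le_lt_trans (le_quasi_integral qf mg fg) goo.
have aef := integrable_ae measurableT if_.
have aeg := integrable_ae measurableT ig.
have [mf _] := qf.
have gf0 : \int[mu]_w (g w - f w) = 0.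
  rewrite integralB//; have -> : \int[mu]_w g w = \int[mu]_w f w.
    by apply/le_anti; rewrite gf (le_quasi_integral qf mg fg).
  by rewrite subee// integrable_fin_num.
have : \int[mu]_w `|g w - f w| = 0.
  rewrite -gf0; apply: ae_eq_integralT.
  - by apply: measurableT_comp => //; exact: emeasurable_funB.
  - exact: emeasurable_funB.
  - apply: filterS2 fg aef => w fg' /(_ I) ff.
    by rewrite gee0_abs// sube_ge0// ff.
have mgf : measurable_fun setT (fun w => g w - f w) by exact: emeasurable_funB.
move=> /(ae_eq_integral_abs mu measurableT mgf) h.
apply: filterS3 h aef aeg => w /(_ I) /= /eqP + /(_ I) ff /(_ I) gg.
by rewrite sube_eq ?add0e// ?fin_num_adde_defl// => /eqP ->.
Qed.

End QuasiIntegrable.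

(** * Measurability and integrable minorants under sub-sigma-algebras *)

Section SubSigma.
Context {R : realType} {d : measure_display} {Omega : measurableType d}.
Variable P : probability Omega R.
Implicit Types G : set (set Omega).

Lemma g_sigma_sub_measurable G : G `<=` measurable -> <<s G >> `<=` measurable.
Proof. by move=> Gm; apply: smallest_sub => //; exact: sigma_algebra_measurable. Qed.

Lemma random_vector_sub G G' (E : normedModType R) (x : Omega -> E) :
  G `<=` G' -> random_vector G x -> random_vector G' x.
Proof.
move=> GG' /random_vectorP bx; apply/random_vectorP => V oV.
by apply: (sub_sigma_algebra2 GG'); exact: bx.
Qed.

Lemma random_vector_borel G (E : normedModType R) (x : Omega -> E) :
  G `<=` measurable -> random_vector G x -> borel x.
Proof.
move=> Gm /random_vectorP bx V oV.
by apply: (g_sigma_sub_measurable Gm); exact: bx.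
Qed.

Lemma random_vector_comp G (E E' : normedModType R) (phi : E -> E') (x : Omega -> E) :
  continuous phi -> random_vector G x -> random_vector G (fun w => phi (x w)).
Proof.
move=> cphi /random_vectorP bx; apply/random_vectorP.
exact: (@borel_comp _ _ (g_sigma_algebraType G)).
Qed.

Lemma random_vector_pair G (E E' : normedModType R) (x : Omega -> E) (y : Omega -> E') :
  separable_space E -> separable_space E' ->
  random_vector G x -> random_vector G y -> random_vector G (fun w => (x w, y w)).
Proof.
move=> sE sE' /random_vectorP bx /random_vectorP by_; apply/random_vectorP.
exact: (@borel_pair _ _ (g_sigma_algebraType G)).
Qed.

Lemma normal_integrand_eval G (E : normedModType R) (h : E -> Omega -> \bar R)
    (x : Omega -> E) : separable_space E -> G `<=` measurable ->
  normal_integrand G h -> borel x -> measurable_fun setT (fun w => h (x w) w).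
Proof.
move=> sE Gm nh; apply: random_lsc_eval.
have [U [V [mU oV hE]]] := normal_random_lsc sE nh.
by exists U, V; split=> // k; apply: (g_sigma_sub_measurable Gm); exact: mU.
Qed.

Lemma normal_integrand_quasi G (E : normedModType R) (h : E -> Omega -> \bar R)
    (x : Omega -> E) : separable_space E -> G `<=` measurable ->
  lb_convex_normal_integrand P G h -> borel x ->
  quasi_integrable P (fun w => h (x w) w).
Proof.
move=> sE Gm [nh _ [m [im mh]]] bx; split; first exact: normal_integrand_eval nh bx.
by exists m; split=> //; apply: filterS mh => w.
Qed.

Lemma lower_boundedP G (E : normedModType R) (h : E -> Omega -> \bar R) :
  lb_convex_normal_integrand P G h ->
  {ae P, forall w, exists r : R, forall z, (r%:E <= h z w)%E}.
Proof. by move=> [_ _ [m [_ mh]]]; apply: filterS mh => w mh; exists (m w). Qed.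

Lemma ae_foralln (A : nat -> Omega -> Prop) :
  (forall n, {ae P, forall w, A n w}) -> {ae P, forall w, forall n, A n w}.
Proof.
move=> hA; have := negligible_bigcup hA; apply: negligibleS => w /= /existsNP[n nA].
by exists n.
Qed.

Lemma quasi_integrable_cst (r : R) : quasi_integrable P (fun=> r%:E).
Proof.
split=> //; exists (fun=> r); split; first exact: finite_measure_integrable_cst.
exact: aeW.
Qed.

Lemma quasi_integralD_cst (f : Omega -> \bar R) (e : R) : quasi_integrable P f ->
  (\int[P]_w (f w + e%:E) = \int[P]_w f w + e%:E)%E.
Proof.
move=> qf; rewrite (quasi_integralD qf (quasi_integrable_cst e)); congr (_ + _)%E.
by rewrite (integral_cst P measurableT)/= probability_setT mule1.
Qed.

End SubSigma.

Lemma adde_fin_inj {R : realType} (a b c : \bar R) :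
  (a + b)%E \is a fin_num -> (a + b = a + c)%E -> b = c /\ b \is a fin_num.
Proof.
case: a b c => [a| |] [b| |] [c| |] //= _; rewrite -?EFinD => -[].
by move=> /addrI ->.
Qed.

Section Infima.
Context {R : realType}.
Local Open Scope ereal_scope.

Lemma ereal_inf_range_prod (A B : Type) (f : A * B -> \bar R) :
  ereal_inf (range f) = ereal_inf (range (fun a => ereal_inf (range (fun b => f (a, b))))).
Proof.
apply/le_anti/andP; split.
  apply: le_ereal_inf_tmp => _ [a _ <-]; apply: le_ereal_inf_tmp => _ [b _ <-].
  by apply: ereal_inf_lbound; exists (a, b).
apply: le_ereal_inf_tmp => _ [[a b] _ <-].
apply: (@le_trans _ _ (ereal_inf (range (fun b => f (a, b))))).
  by apply: ereal_inf_lbound; exists a.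
by apply: ereal_inf_lbound; exists b.
Qed.

Lemma ereal_inf_range_cst (A : Type) (a : A) (c : \bar R) :
  ereal_inf (range (fun _ : A => c)) = c.
Proof.
apply/le_anti/andP; split; first by apply: ereal_inf_lbound; exists a.
by apply: le_ereal_inf_tmp => _ [b _ <-].
Qed.

Lemma ereal_inf_lb_range (A : Type) (f : A -> \bar R) a :
  ereal_inf (range f) <= f a.
Proof. by apply: ereal_inf_lbound; exists a. Qed.

(* The bound on the infima matters where g is +oo, because +oo + -oo = -oo. *)
Lemma ereal_infD_range (A B : Type) (g : A -> \bar R) (f : A * B -> \bar R) :
  (forall a, -oo < g a) -> (forall a, -oo < ereal_inf (range (fun b => f (a, b)))) ->
  ereal_inf (range (fun p => g p.1 + f p)) =
  ereal_inf (range (fun a => g a + ereal_inf (range (fun b => f (a, b))))).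
Proof.
move=> gNy fNy; rewrite ereal_inf_range_prod; congr ereal_inf.
apply: eq_imagel => a _ /=.
move: (gNy a) (fNy a); case: (g a) => [x _ _| _ fa|//].
- apply/le_anti/andP; split.
    rewrite -leeBlDl//; apply: le_ereal_inf_tmp => _ [b _ <-].
    by rewrite leeBlDl//; exact: (@ereal_inf_lb_range _ (fun b => x%:E + f (a, b))).
  apply: le_ereal_inf_tmp => _ [b _ <-]; rewrite leeD2l//.
  exact: (@ereal_inf_lb_range _ (fun b => f (a, b))).
- rewrite addye ?gt_eqF//; apply/eqP; rewrite -leye_eq.
  apply: le_ereal_inf_tmp => _ [b _ <-]; rewrite addye// gt_eqF// (lt_le_trans fa)//.
  exact: (@ereal_inf_lb_range _ (fun b => f (a, b))).
Qed.

End Infima.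

(** * Dynamic programming *)

Section Bellman.
Context {R : realType} {d : measure_display} {Omega : measurableType d}.
Context (P : probability Omega R) (T N M : nat) (F : nat -> set (set Omega)).
Context (K : nat -> 'rV[R]_N * 'rV[R]_M * 'rV[R]_N -> Omega -> \bar R).
Context (J : 'rV[R]_N -> Omega -> \bar R) (Jt : nat -> 'rV[R]_N -> Omega -> \bar R).
Context (Q EQ : nat -> 'rV[R]_N * 'rV[R]_M -> Omega -> \bar R).
Context (hF : filtration_upto F T).
Context (hK : forall t, (1 <= t <= T)%N -> lb_convex_normal_integrand P (F t) (K t)).
Context (hJ : lb_convex_normal_integrand P (F T) J).
Context (hEQ : forall t, (t < T)%N -> is_cond_integrand P (F t) (Q t) (EQ t)).
Context (hB : reduced_bellman_solution P K T J Jt Q EQ).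

Implicit Types (XU : process (R := R) (Omega := Omega) N M) (s t : nat).

(** * Measurability and integrable minorants of the costs *)

Definition running_cost s XU w :=
  (\sum_(1 <= t < s.+1) K t (XU.1 t.-1 w, XU.2 t.-1 w, XU.1 t w) w)%E.

Lemma costE s V XU :
  cost P K s V XU = (\int[P]_w (running_cost s XU w + V (XU.1 s w) w))%E.
Proof. by []. Qed.

Lemma running_costS s XU w : running_cost s.+1 XU w =
  (running_cost s XU w + K s.+1 (XU.1 s w, XU.2 s w, XU.1 s.+1 w) w)%E.
Proof. by rewrite /running_cost big_nat_recr. Qed.

Lemma F_measurable t : (t <= T)%N -> F t `<=` measurable.
Proof. by case: hF => _ h _; exact: h. Qed.

Lemma adapted_le s s' XU : (s <= s')%N -> adapted F s' XU -> adapted F s XU.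
Proof. by move=> ss' aXU t ts; apply: aXU; exact: leq_trans ts ss'. Qed.

Lemma adapted_state s t XU : (t <= s)%N -> adapted F s XU ->
  random_vector (F t) (XU.1 t).
Proof.
move=> ts /(_ t ts).
exact: (@random_vector_comp _ _ _ _ _ _ fst _ continuous_fst).
Qed.

Lemma adapted_step s XU : (s < T)%N -> adapted F s.+1 XU ->
  random_vector (F s.+1) (fun w => (XU.1 s w, XU.2 s w, XU.1 s.+1 w)).
Proof.
move=> sT aXU; apply: random_vector_pair.
- exact: separable_prod (separable_rV _) (separable_rV _).
- exact: separable_rV.
- apply: (@random_vector_sub _ _ _ (F s)); last exact: (aXU s (leqnSn s)).
  by case: hF => _ _ h; exact: h.
- exact: (adapted_state _ aXU).
Qed.

Lemma running_cost_quasi s XU : (s <= T)%N -> adapted F s XU ->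
  quasi_integrable P (running_cost s XU).
Proof.
elim: s => [|s IH] sT aXU.
  rewrite (_ : running_cost 0%N XU = fun=> 0%:E); first exact: quasi_integrable_cst.
  by apply/funext => w; rewrite /running_cost big_geq.
rewrite (_ : running_cost s.+1 XU = fun w => (running_cost s XU w +
    K s.+1 (XU.1 s w, XU.2 s w, XU.1 s.+1 w) w)%E); last first.
  by apply/funext => w; rewrite running_costS.
apply: quasi_integrableD; first by apply: IH; [exact: ltnW|exact: adapted_le aXU].
apply: (normal_integrand_quasi _ (F_measurable sT)).
- apply: separable_prod (separable_rV _).
  exact: separable_prod (separable_rV _) (separable_rV _).
- by apply: hK; rewrite sT.
- exact: random_vector_borel (F_measurable sT) (adapted_step sT aXU).
Qed.

Lemma value_quasi t (x : Omega -> 'rV[R]_N) : (t <= T)%N ->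
  random_vector (F t) x -> quasi_integrable P (fun w => Jt t (x w) w).
Proof.
move=> tT bx; case: hB => /(_ t tT) lbJ _ _.
apply: (normal_integrand_quasi (separable_rV _) _ lbJ) => //.
exact: random_vector_borel (F_measurable tT) bx.
Qed.

Lemma Q_quasi t XU : (t < T)%N -> adapted F t XU ->
  quasi_integrable P (fun w => Q t (XU.1 t w, XU.2 t w) w).
Proof.
move=> tT aXU; case: hB => _ /(_ t tT) lbQ _.
apply: (normal_integrand_quasi _ _ lbQ) => //.
  exact: separable_prod (separable_rV _) (separable_rV _).
exact: random_vector_borel (F_measurable (ltnW tT)) (aXU t (leqnn t)).
Qed.

(** * One-step comparison of costs *)

Lemma value_le_EQ t : (t < T)%N ->
  {ae P, forall w, forall x u, (Jt t x w <= EQ t (x, u) w)%E}.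
Proof.
move=> tT; case: hB => _ _; apply: filterS => w [_ /(_ t tT)[_ JE]] x u.
by rewrite JE; exact: (@ereal_inf_lb_range _ _ (fun u => EQ t (x, u) w)).
Qed.

Lemma Q_le_step t : (t < T)%N ->
  {ae P, forall w, forall x u y,
    (Q t (x, u) w <= K t.+1 (x, u, y) w + Jt t.+1 y w)%E}.
Proof.
move=> tT; case: hB => _ _; apply: filterS => w [_ /(_ t tT)[QE _]] x u y.
by rewrite QE; exact: (@ereal_inf_lb_range _ _ (fun y => K t.+1 (x, u, y) w + Jt t.+1 y w)%E).
Qed.

Lemma EQ_measurable t XU : (t < T)%N -> adapted F t XU ->
  measurable_fun setT (fun w => EQ t (XU.1 t w, XU.2 t w) w).
Proof.
move=> tT aXU; have [nEQ _] := hEQ tT.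
apply: (normal_integrand_eval _ (F_measurable (ltnW tT)) nEQ).
  exact: separable_prod (separable_rV _) (separable_rV _).
exact: random_vector_borel (F_measurable (ltnW tT)) (aXU t (leqnn t)).
Qed.

(** [is_cond_integrand] contains no lower bound for [EQ]; the integrable minorant is inherited from
    [Jt], which lies below [EQ] by the Bellman equation. *)
Lemma EQ_quasi t XU : (t < T)%N -> adapted F t XU ->
  quasi_integrable P (fun w => EQ t (XU.1 t w, XU.2 t w) w).
Proof.
move=> tT aXU.
apply: (quasi_le (value_quasi (ltnW tT) (adapted_state (leqnn t) aXU))).
  exact: EQ_measurable.
by apply: filterS (value_le_EQ tT) => w.
Qed.

Definition cost_Q s XU : \bar R :=
  (\int[P]_w (running_cost s XU w + Q s (XU.1 s w, XU.2 s w) w))%E.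

(* No factor has to be pulled out of a conditional expectation: the integral splits
   and E_s Q_s has the same integral over Omega as Q_s. *)
Lemma cost_Q_EQ s XU : (s < T)%N -> adapted F s XU -> cost_Q s XU =
  (\int[P]_w (running_cost s XU w + EQ s (XU.1 s w, XU.2 s w) w))%E.
Proof.
move=> sT aXU; have rq := running_cost_quasi (ltnW sT) aXU.
rewrite /cost_Q (quasi_integralD rq (Q_quasi sT aXU)).
rewrite (quasi_integralD rq (EQ_quasi sT aXU)); congr (_ + _)%E.
have [_ /(_ _ (aXU s (leqnn s)))[_ ->]//] := hEQ sT.
have [/(_ s (ltnW sT)) [F0 FC _] _ _] := hF.
by rewrite -(setD0 setT); exact: FC.
Qed.

Lemma cost_le_cost_Q s XU : (s < T)%N -> adapted F s XU ->
  (cost P K s (Jt s) XU <= cost_Q s XU)%E.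
Proof.
move=> sT aXU; rewrite costE (cost_Q_EQ sT aXU).
have rq := running_cost_quasi (ltnW sT) aXU.
apply: le_quasi_integral.
- apply: quasi_integrableD rq _.
  exact: value_quasi (ltnW sT) (adapted_state (leqnn s) aXU).
- by have [] := quasi_integrableD rq (EQ_quasi sT aXU).
- by apply: filterS (value_le_EQ sT) => w h; rewrite leeD2l.
Qed.

Lemma cost_succE s XU : cost P K s.+1 (Jt s.+1) XU =
  (\int[P]_w (running_cost s XU w +
     (K s.+1 (XU.1 s w, XU.2 s w, XU.1 s.+1 w) w + Jt s.+1 (XU.1 s.+1 w) w)))%E.
Proof. by rewrite costE; apply: eq_integral => w _; rewrite running_costS addeA. Qed.

Lemma step_quasi s XU : (s < T)%N -> adapted F s.+1 XU ->
  quasi_integrable P (fun w => K s.+1 (XU.1 s w, XU.2 s w, XU.1 s.+1 w) w +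
    Jt s.+1 (XU.1 s.+1 w) w)%E.
Proof.
move=> sT aXU; apply: quasi_integrableD.
  apply: (normal_integrand_quasi _ (F_measurable sT)).
  - apply: separable_prod (separable_rV _).
    exact: separable_prod (separable_rV _) (separable_rV _).
  - by apply: hK; rewrite sT.
  - exact: random_vector_borel (F_measurable sT) (adapted_step sT aXU).
exact: value_quasi sT (adapted_state (leqnn _) aXU).
Qed.

Lemma cost_Q_le_cost s XU : (s < T)%N -> adapted F s.+1 XU ->
  (cost_Q s XU <= cost P K s.+1 (Jt s.+1) XU)%E.
Proof.
move=> sT aXU; rewrite cost_succE /cost_Q.
have aXU' := adapted_le (leqnSn s) aXU.
have rq := running_cost_quasi (ltnW sT) aXU'.
apply: le_quasi_integral.
- exact: quasi_integrableD rq (Q_quasi sT aXU').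
- by have [] := quasi_integrableD rq (step_quasi sT aXU).
- by apply: filterS (Q_le_step sT) => w h; rewrite leeD2l.
Qed.

(* J_t need only be F-measurable; up to a null set it is the infimal projection
   of an F_t-measurable integrand, to which measurable selection applies. *)
Lemma value_repr t : (t <= T)%N ->
  exists H : 'rV[R]_N * 'rV[R]_M -> Omega -> \bar R,
    @random_lsc _ _ (g_sigma_algebraType (F t)) _ H /\
    {ae P, forall w, forall x, Jt t x w = ereal_inf (range (fun u => H (x, u) w))}.
Proof.
rewrite leq_eqVlt => /predU1P[->|tT].
  exists (fun p => J p.1); split.
    apply: (@random_lsc_comp _ _ (g_sigma_algebraType (F T)) _ _ _ J continuous_fst).
    by apply: normal_random_lsc; [exact: separable_rV|case: hJ].
  case: hB => _ _; apply: filterS => w [JE _] x.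
  by rewrite JE; apply/esym; exact: (@ereal_inf_range_cst _ 'rV[R]_M 0 (J x w)).
exists (EQ t); split.
  apply: normal_random_lsc; last by case: (hEQ tT).
  exact: separable_prod (separable_rV _) (separable_rV _).
by case: hB => _ _; apply: filterS => w [_ /(_ t tT)[]].
Qed.

Lemma value_lb t : (t <= T)%N ->
  {ae P, forall w, exists r : R, forall x, (r%:E <= Jt t x w)%E}.
Proof. by move=> tT; case: hB => /(_ t tT)/lower_boundedP. Qed.

Lemma sep_XU : separable_space ('rV[R]_N * 'rV[R]_M)%type.
Proof. exact: separable_prod (separable_rV _) (separable_rV _). Qed.

Lemma proper_XU : proper_space ('rV[R]_N * 'rV[R]_M)%type.
Proof. exact: proper_prod (proper_rV (n := _)) (proper_rV (n := _)). Qed.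

(** The joint infimum of [H] over states and controls equals the infimum of [Jt 0], so the state
    part of a joint near-minimizer is a near-minimizer of [Jt 0]. *)
Lemma eps_initial (e : R) : 0 < e -> exists XU, adapted F 0%N XU /\
  {ae P, forall w, (Jt 0%N (XU.1 0%N w) w <= ereal_inf (range (Jt 0%N ^~ w)) + e%:E)%E}.
Proof.
move=> e0; have [H [rH JH]] := value_repr (leq0n T).
have [z [bz hz]] :=
  @random_lsc_eps_min _ _ (g_sigma_algebraType (F 0%N)) _ _ rH e sep_XU proper_XU e0.
exists (fun _ w => (z w).1, fun _ w => (z w).2); split.
  move=> t; rewrite leqn0 => /eqP ->; apply/random_vectorP.
  by rewrite (_ : (fun w => _) = z)//; apply/funext => w /=; case: (z w).
apply: filterS2 JH (value_lb (leq0n T)) => w JH [r rJ] /=.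
have infE : ereal_inf (range (Jt 0%N ^~ w)) = ereal_inf (range (H ^~ w)).
  by rewrite ereal_inf_range_prod; congr ereal_inf; apply: eq_imagel => x _.
have JleH : (Jt 0%N (z w).1 w <= H (z w) w)%E.
  rewrite JH [in leRHS](surjective_pairing (z w)).
  exact: (@ereal_inf_lb_range _ _ (fun u => H ((z w).1, u) w)).
have [Ioo|Ifin] := eqVneq (ereal_inf (range (H ^~ w))) +oo%E.
  by rewrite infE Ioo leey.
apply: (le_trans JleH); rewrite infE; apply: hz.
rewrite fin_numE Ifin andbT -infE gt_eqF// (lt_le_trans (ltNyr r))//.
by apply: le_ereal_inf_tmp => _ [x _ <-].
Qed.

(** The control at time [s] is chosen anew, which is harmless because the cost truncated at [s] does
    not see it. The next state comes from a joint near-minimizer of K_{s+1} + H, where [H] is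
    measurable for the sigma-algebra of time s+1 and projects to J_{s+1}. *)
Lemma eps_step s XU (e : R) : (s < T)%N -> adapted F s XU -> 0 < e ->
  exists XU' : process N M, [/\ adapted F s.+1 XU',
    running_cost s XU' = running_cost s XU, XU'.1 s = XU.1 s,
    {ae P, forall w,
      (EQ s (XU'.1 s w, XU'.2 s w) w <= Jt s (XU.1 s w) w + e%:E)%E} &
    {ae P, forall w,
      (K s.+1 (XU'.1 s w, XU'.2 s w, XU'.1 s.+1 w) w + Jt s.+1 (XU'.1 s.+1 w) w
       <= Q s (XU'.1 s w, XU'.2 s w) w + e%:E)%E}].
Proof.
move=> sT aXU e0; have sT' := ltnW sT.
have bX : @borel _ _ (g_sigma_algebraType (F s)) _ (XU.1 s).
  by apply/random_vectorP; exact: (adapted_state _ aXU).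
have rEQ : @random_lsc _ _ (g_sigma_algebraType (F s)) _ (EQ s).
  by apply: normal_random_lsc; [exact: sep_XU|case: (hEQ sT)].
have rEQ1 := @random_lsc_pull _ _ (g_sigma_algebraType (F s)) _ _ _ id _ _
  (separable_rV _) continuous_id bX rEQ.
have [u [bu hu]] := random_lsc_eps_min rEQ1 (separable_rV _) (proper_rV (n := _)) e0.
have aXu : random_vector (F s) (fun w => (XU.1 s w, u w)).
  apply: random_vector_pair; [exact: separable_rV|exact: separable_rV| |].
  - exact: (adapted_state _ aXU).
  - exact/random_vectorP.
have [H [rH JH]] := value_repr sT.
have aXu1 : random_vector (F s.+1) (fun w => (XU.1 s w, u w)).
  by apply: random_vector_sub aXu; case: hF => _ _; apply.
have rK : @random_lsc _ _ (g_sigma_algebraType (F s.+1)) _ (K s.+1).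
  apply: normal_random_lsc; first exact: separable_prod sep_XU (separable_rV _).
  by have [] := hK (t := s.+1) sT.
have rK1 := @random_lsc_pull _ _ (g_sigma_algebraType (F s.+1)) _ _ _
  (fun p : ('rV[R]_N * 'rV[R]_M) * ('rV[R]_N * 'rV[R]_M) => (p.1, p.2.1)) _ _ sep_XU _
  ((random_vectorP _ _).1 aXu1) rK.
have [|z [bz hz]] := random_lsc_eps_min (random_lsc_add (rK1 _) rH) sep_XU proper_XU e0.
  apply: continuous_pair; first exact: continuous_fst.
  by apply: continuous_compT; [exact: continuous_snd|exact: continuous_fst].
pose X' t := if t == s.+1 then fun w => (z w).1 else XU.1 t.
pose U' t := if t == s.+1 then fun w => (z w).2 else if t == s then u else XU.2 t.
have X't t : (t <= s)%N -> X' t = XU.1 t by move=> ts; rewrite /X' ltn_eqF.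
have U't t : (t < s)%N -> U' t = XU.2 t.
  by move=> ts; rewrite /U' (ltn_eqF ts) (@ltn_eqF t s.+1)// ltnS ltnW.
have X's := X't s (leqnn s).
have U's : U' s = u by rewrite /U' eqxx ltn_eqF.
have X's1 : X' s.+1 = fun w => (z w).1 by rewrite /X' eqxx.
exists (X', U'); split => //=.
- move=> t; rewrite leq_eqVlt => /predU1P[->|].
    rewrite /= X's1 /U' eqxx; apply/random_vectorP.
    by rewrite (_ : (fun w => _) = z)//; apply/funext => w /=; case: (z w).
  rewrite ltnS leq_eqVlt => /predU1P[->|ts]; first by rewrite /= X's U's.
  by rewrite /= X't ?U't//; [apply: aXU|]; exact: ltnW.
(* The running cost up to [s] involves controls only up to time s-1, and these are unchanged. *)
- apply/funext => w; apply: eq_big_nat => t /andP[t0 ts] /=.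
  case: t t0 ts => // t _; rewrite ltnS => ts /=.
  by rewrite (X't t (ltnW ts)) (X't t.+1 ts) (U't t ts).
- case: hB => _ _ bell; apply: filterS2 (value_lb sT') bell => w [r rJ] [_ /(_ s sT)[_ JE]].
  (* An infinite infimum makes the bound trivial; otherwise the lower bound on [Jt] makes it finite,
     as the selection lemma requires. *)
  rewrite X's U's; have [->|Joo] := eqVneq (Jt s (XU.1 s w) w) +oo%E.
    by rewrite addye ?leey.
  rewrite JE; apply: hu.
  by rewrite fin_numE -JE Joo andbT gt_eqF// (lt_le_trans (ltNyr r)).
- have lbK := lower_boundedP (hK (t := s.+1) sT).
  case: hB => _ _ bell.
  apply: filterS3 JH lbK (filterI (value_lb sT) bell) => w JH [k kK].
  move=> [[r rJ] [_ /(_ s sT)[QE _]]]; rewrite X's U's X's1.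
  have infE : ereal_inf (range (fun p =>
      (K s.+1 (XU.1 s w, u w, p.1) w + H p w)%E)) = Q s (XU.1 s w, u w) w.
    rewrite QE (@ereal_infD_range _ _ _ (fun y => K s.+1 (XU.1 s w, u w, y) w)
      (fun p => H p w)).
    - by congr ereal_inf; apply: eq_imagel => y _; rewrite JH.
    - by move=> y; exact: lt_le_trans (ltNyr k) (kK _).
    - by move=> y; rewrite -JH; exact: lt_le_trans (ltNyr r) (rJ _).
  have [->|Qoo] := eqVneq (Q s (XU.1 s w, u w) w) +oo%E; first by rewrite addye ?leey.
  apply: (@le_trans _ _ (K s.+1 (XU.1 s w, u w, (z w).1) w + H (z w) w)%E).
    rewrite leeD2l// JH [in leRHS](surjective_pairing (z w)).
    exact: (@ereal_inf_lb_range _ _ (fun u => H ((z w).1, u) w)).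
  rewrite -infE; apply: hz; rewrite fin_numE infE Qoo andbT gt_eqF//.
  rewrite (lt_le_trans (ltNyr (k + r)%R))// QE; apply: le_ereal_inf_tmp => _ [y _ <-].
  by rewrite EFinD leeD.
Qed.

(** * Equality of the optimum values *)

Lemma optimum_le_succ s : (s < T)%N ->
  (optimum_value P F K s (Jt s) <= optimum_value P F K s.+1 (Jt s.+1))%E.
Proof.
move=> sT; apply: le_ereal_inf_tmp => _ [XU aXU <-].
have aXU' := adapted_le (leqnSn s) aXU.
apply: le_trans (le_trans (cost_le_cost_Q sT aXU') (cost_Q_le_cost sT aXU)).
by apply: ereal_inf_lbound; exists XU.
Qed.

Lemma optimum_succ_le s : (s < T)%N ->
  (optimum_value P F K s.+1 (Jt s.+1) <= optimum_value P F K s (Jt s))%E.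
Proof.
move=> sT; apply: le_ereal_inf_tmp => _ [XU aXU <-].
(* Half of [e] pays for the choice of the control, the other half for the choice of the next
   state. *)
apply/lee_addgt0Pr => e e0; have e20 : 0 < e / 2 by rewrite divr_gt0.
have [XU' [aXU' rE XE EQle Kle]] := eps_step sT aXU e20.
apply: (@le_trans _ _ (cost P K s.+1 (Jt s.+1) XU')).
  by apply: ereal_inf_lbound; exists XU'.
have aXUs := adapted_le (leqnSn s) aXU'.
have rq := running_cost_quasi (ltnW sT) aXUs.
have qQ := quasi_integrableD rq (Q_quasi sT aXUs).
have qJ := quasi_integrableD rq
  (value_quasi (ltnW sT) (adapted_state (leqnn s) aXUs)).
have -> : cost P K s (Jt s) XU = cost P K s (Jt s) XU'.
  by rewrite !costE rE XE.
rewrite [e in leRHS]splitr EFinD addeA -[cost P K s _ _ + _]quasi_integralD_cst//.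
apply: (@le_trans _ _ (cost_Q s XU' + (e / 2)%:E)).
  rewrite cost_succE -quasi_integralD_cst//.
  apply: le_quasi_integral.
  - exact: quasi_integrableD rq (step_quasi sT aXU').
  - by have [] := quasi_integrableD qQ (quasi_integrable_cst P (e / 2)).
  - by apply: filterS Kle => w h; rewrite -addeA leeD2l.
rewrite leeD2r// (cost_Q_EQ sT aXUs); apply: le_quasi_integral.
- exact: quasi_integrableD rq (EQ_quasi sT aXUs).
- by have [] := quasi_integrableD qJ (quasi_integrable_cst P (e / 2)).
- by apply: filterS EQle => w; rewrite -XE -addeA => h; rewrite leeD2l.
Qed.

Lemma cost_terminal XU : adapted F T XU -> cost P K T J XU = cost P K T (Jt T) XU.
Proof.
move=> aXU; have rq := running_cost_quasi (leqnn T) aXU.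
have bX := adapted_state (leqnn T) aXU.
rewrite !costE; apply: ae_eq_integralT.
- have [] // := quasi_integrableD rq
    (normal_integrand_quasi (separable_rV _) (F_measurable (leqnn T)) hJ
      (random_vector_borel (F_measurable (leqnn T)) bX)).
- by have [] := quasi_integrableD rq (value_quasi (leqnn T) bX).
- by case: hB => _ _; apply: filterS => w [-> _].
Qed.

Lemma optimum_terminal :
  optimum_value P F K T J = optimum_value P F K T (Jt T).
Proof. by congr ereal_inf; apply: eq_imagel => XU; exact: cost_terminal. Qed.

Lemma optimum_valueE s : (s <= T)%N ->
  optimum_value P F K T J = optimum_value P F K s (Jt s).
Proof.
move=> sT; rewrite optimum_terminal.
suff h k : (s + k <= T)%N ->
    optimum_value P F K (s + k) (Jt (s + k)) = optimum_value P F K s (Jt s).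
  by have := h (T - s)%N; rewrite subnKC//; exact.
elim: k => [|k IH]; first by rewrite addn0.
rewrite addnS => skT; rewrite -(IH (ltnW skT)); apply/le_anti.
by rewrite optimum_succ_le//= optimum_le_succ.
Qed.

Lemma cost_mono s s' XU : (s <= s' <= T)%N -> adapted F s' XU ->
  (cost P K s (Jt s) XU <= cost P K s' (Jt s') XU)%E.
Proof.
move=> /andP[]; elim: s' => [|s' IH]; first by rewrite leqn0 => /eqP ->.
rewrite leq_eqVlt => /predU1P[->//|]; rewrite ltnS => ss' s'T aXU.
have aXU' := adapted_le (leqnSn s') aXU.
apply: (le_trans (IH ss' (ltnW s'T) aXU')).
exact: le_trans (cost_le_cost_Q s'T aXU') (cost_Q_le_cost s'T aXU).
Qed.

(** * Optimality conditions *)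

Lemma cost0E XU : cost P K 0 (Jt 0%N) XU = (\int[P]_w Jt 0%N (XU.1 0%N w) w)%E.
Proof.
by rewrite costE; apply: eq_integral => w _; rewrite /running_cost big_geq// add0e.
Qed.

Definition inf_value0 w := ereal_inf (range (Jt 0%N ^~ w)).

(** The infimum is below [a] exactly when the epigraph meets the open half-space of heights below
    [a], which is a hitting event of the normal integrand. *)
Lemma inf_value0_quasi : quasi_integrable P inf_value0.
Proof.
case: hB => /(_ 0%N (leq0n T))[nJ _ [m [im mJ]]] _ _; split; last first.
  exists m; split=> //; apply: filterS mJ => w mJ.
  by apply: le_ereal_inf_tmp => _ [x _ <-].
move=> mD; apply: (measurability _ (ErealGenInftyO.measurableE R)) => //.
move=> _ [_ [a ->]] <-; rewrite setTI.
have oa : open ((snd : 'rV[R]_N * R^o -> R^o) @^-1` [set r : R | r < a]).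
  by move/continuousP: (@continuous_snd 'rV[R]_N R^o); apply; exact: open_lt.
have [_ /(_ _ oa)] := nJ.
congr measurable; apply/seteqP; split => w /=.
  move=> [[x r] [/= Jr ra]]; rewrite in_itv /=.
  apply: le_lt_trans (ereal_inf_lb_range (Jt 0%N ^~ w) x) _.
  by rewrite (le_lt_trans Jr)// lte_fin.
rewrite in_itv /= => /ereal_inf_lt[_ [x _ <-]].
case Jx : (Jt 0%N x w) => [r| |] // Ja.
  by exists (x, r); split; [rewrite /epi /= Jx|rewrite /= -lte_fin].
(* The value -oo may occur on the null set where the lower bound fails; any height below [a] then
   lies in the epigraph. *)
exists (x, (a - 1)%R); split; first by rewrite /epi /= Jx leNye.
by rewrite /= ltrBlDr ltrDl.
Qed.

(** [eps_initial] bounds the optimum at time 0 by the integral of the pointwise infimum. Hence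
    J_0(X_0) and its minorant inf J_0 have the same finite integral and agree almost surely. *)
Lemma value0_minimal XU : adapted F 0 XU ->
  (cost P K 0 (Jt 0%N) XU <= optimum_value P F K 0 (Jt 0%N))%E ->
  (cost P K 0 (Jt 0%N) XU < +oo)%E ->
  {ae P, forall w, argmin (Jt 0%N ^~ w) (XU.1 0%N w)}.
Proof.
move=> aXU copt coo.
have mJ : measurable_fun setT (fun w => Jt 0%N (XU.1 0%N w) w).
  by have [] := value_quasi (leq0n T) (adapted_state (leqnn 0) aXU).
have infle : {ae P, forall w, (inf_value0 w <= Jt 0%N (XU.1 0%N w) w)%E}.
  by apply: aeW => w; exact: (@ereal_inf_lb_range _ _ (Jt 0%N ^~ w)).
have := quasi_integral_ae_eq inf_value0_quasi mJ infle.
rewrite -cost0E => /(_ _ coo) h; apply: filterS (h _) => [w [E ffin]|].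
  by split; rewrite -E// ltey_eq ffin.
apply/lee_addgt0Pr => e e0.
have [XU' [aXU' leXU']] := eps_initial e0.
apply: (le_trans copt); apply: (@le_trans _ _ (cost P K 0 (Jt 0%N) XU')).
  by apply: ereal_inf_lbound; exists XU'.
rewrite cost0E -(quasi_integralD_cst _ inf_value0_quasi).
apply: le_quasi_integral leXU'.
  exact: value_quasi (leq0n T) (adapted_state (leqnn 0) aXU').
by have [] := quasi_integrableD inf_value0_quasi (quasi_integrable_cst P e).
Qed.

Lemma solution_step s XU v : (s < T)%N -> adapted F s.+1 XU -> (v < +oo)%E ->
  cost P K s (Jt s) XU = v -> cost P K s.+1 (Jt s.+1) XU = v ->
  {ae P, forall w,
     argmin (fun u => EQ s (XU.1 s w, u) w) (XU.2 s w) /\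
     argmin (fun y => (K s.+1 (XU.1 s w, XU.2 s w, y) w + Jt s.+1 y w)%E)
       (XU.1 s.+1 w)}.
Proof.
move=> sT aXU voo csE cs1E.
have aXU' := adapted_le (leqnSn s) aXU.
have cQE : cost_Q s XU = v.
  apply/le_anti; rewrite -{1}cs1E cost_Q_le_cost//= -csE.
  exact: cost_le_cost_Q.
have rq := running_cost_quasi (ltnW sT) aXU'.
have qJ := quasi_integrableD rq
  (value_quasi (ltnW sT) (adapted_state (leqnn s) aXU')).
have qQ := quasi_integrableD rq (Q_quasi sT aXU').
have [mEQ _] := quasi_integrableD rq (EQ_quasi sT aXU').
have [mS _] := quasi_integrableD rq (step_quasi sT aXU).
have h1 := quasi_integral_ae_eq qJ mEQ.
have h2 := quasi_integral_ae_eq qQ mS.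
move: h1 h2; rewrite -(cost_Q_EQ sT aXU') -cost_succE -costE -/(cost_Q s XU).
rewrite cs1E cQE csE => /(_ _ (lexx _) voo) h1 /(_ _ (lexx _) voo) h2.
(* The equalities obtained so far include the running cost; it cancels because the sums are finite
   almost surely. *)
have {}h1 : {ae P, forall w, EQ s (XU.1 s w, XU.2 s w) w = Jt s (XU.1 s w) w /\
    Jt s (XU.1 s w) w \is a fin_num}.
  apply: filterS (h1 _) => [w [E fE]|].
    by have [<- ?] := adde_fin_inj fE E.
  by apply: filterS (value_le_EQ sT) => w h; rewrite leeD2l.
have {}h2 : {ae P, forall w,
    (K s.+1 (XU.1 s w, XU.2 s w, XU.1 s.+1 w) w + Jt s.+1 (XU.1 s.+1 w) w)%E =
    Q s (XU.1 s w, XU.2 s w) w /\ Q s (XU.1 s w, XU.2 s w) w \is a fin_num}.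
  apply: filterS (h2 _) => [w [E fE]|].
    by have [<- ?] := adde_fin_inj fE E.
  by apply: filterS (Q_le_step sT) => w h; rewrite leeD2l.
case: (hB) => _ _ bell; apply: filterS3 h1 h2 bell => w [EQE fJ] [KE fQ].
move=> [_ /(_ s sT)[QE JE]]; split; split.
- by rewrite EQE JE.
- by rewrite EQE ltey_eq fJ.
- by rewrite KE QE.
- by rewrite KE ltey_eq fQ.
Qed.

Lemma argmin_step s XU : (s < T)%N -> adapted F s.+1 XU ->
  {ae P, forall w,
     argmin (fun u => EQ s (XU.1 s w, u) w) (XU.2 s w) /\
     argmin (fun y => (K s.+1 (XU.1 s w, XU.2 s w, y) w + Jt s.+1 y w)%E)
       (XU.1 s.+1 w)} ->
  (cost P K s.+1 (Jt s.+1) XU <= cost P K s (Jt s) XU)%E.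
Proof.
move=> sT aXU opt; have aXU' := adapted_le (leqnSn s) aXU.
have rq := running_cost_quasi (ltnW sT) aXU'.
case: (hB) => _ _ bell.
apply: (@le_trans _ _ (cost_Q s XU)).
  rewrite cost_succE; apply: le_quasi_integral.
  - exact: quasi_integrableD rq (step_quasi sT aXU).
  - by have [] := quasi_integrableD rq (Q_quasi sT aXU').
  - apply: filterS2 opt bell => w [_ [KE _]] [_ /(_ s sT)[QE _]].
    by rewrite KE -QE.
rewrite (cost_Q_EQ sT aXU') costE; apply: le_quasi_integral.
- exact: quasi_integrableD rq (EQ_quasi sT aXU').
- by have [] := quasi_integrableD rq
    (value_quasi (ltnW sT) (adapted_state (leqnn s) aXU')).
- apply: filterS2 opt bell => w [[EQE _] _] [_ /(_ s sT)[_ JE]].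
  by rewrite EQE -JE.
Qed.

(* Since F_0 is trivial, one of the increasing events {inf J_0 <= n} has full
   probability once inf J_0 is a.s. below +oo. *)
Lemma inf_value0_bounded :
  sigma_algebra setT (F 0%N) ->
  (forall A, F 0%N A -> P A = 0%E \/ P A = 1%E) ->
  {ae P, forall w, (inf_value0 w < +oo)%E} ->
  exists n : nat, {ae P, forall w, (inf_value0 w <= n%:R%:E)%E}.
Proof.
move=> sF0 F01 infoo; have [H [rH JH]] := value_repr (leq0n T).
(* Nonemptiness of a closed sublevel set of [H] is an event of [F 0] by [rclosed_dom]. It implies
   that the infimum is at most n, and some [A n] occurs whenever the infimum is below +oo. *)
pose A (n : nat) := [set w | [set z | (H z w <= n%:R%:E)%E] !=set0].
have FA n : F 0%N (A n).
  have := rclosed_dom proper_XU (random_lsc_level rH n%:R).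
  by rewrite (measurable_g_measurableTypeE sF0).
have mA n : measurable (A n) by apply: F_measurable (FA n).
have infE : {ae P, forall w, inf_value0 w = ereal_inf (range (H ^~ w))}.
  apply: filterS JH => w JH; rewrite /inf_value0 ereal_inf_range_prod.
  by congr ereal_inf; apply: eq_imagel => x _.
have [n PAn] : exists n, P (A n) = 1%E.
  apply: contrapT => /forallNP nA.
  (* If no [A n] had probability one, triviality would make them all null, and together with two
     exceptional null sets they would cover the whole space. *)
  have nul n : P.-negligible (A n).
    by apply/negligibleP => //; case: (F01 _ (FA n)) => // /nA.
  have : P.-negligible (~` [set w | (inf_value0 w < +oo)%E] `|`
     (~` [set w | inf_value0 w = ereal_inf (range (H ^~ w))] `|` \bigcup_n A n)).
    by apply: negligibleU => //; apply: negligibleU => //; exact: negligible_bigcup.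
  move=> neg; suff : P.-negligible [set: Omega].
    move=> /(negligibleP P measurableT); rewrite /= probability_setT => /eqP.
    by rewrite onee_eq0.
  apply: (negligibleS _ neg) => w _.
  have [io|] := pselect (inf_value0 w < +oo)%E; last by left.
  have [iE|] := pselect (inf_value0 w = ereal_inf (range (H ^~ w))); last by right; left.
  right; right; move: io; rewrite iE => /ereal_inf_lt[_ [z _ <-] Hz].
  exists (Num.truncn (fine (H z w))).+1 => //; exists z => /=.
  case: (H z w) Hz => [r _| |] //=; last by rewrite leNye.
  by rewrite lee_fin ltW// truncnS_gt.
exists n.
have aeA : {ae P, forall w, A n w}.
  exists (~` A n); split; first exact: measurableC.
    by rewrite /= probability_setC// PAn subee.
  exact: subset_refl.
apply: filterS2 infE aeA => w -> [z /= Hz].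
exact: le_trans (ereal_inf_lb_range (H ^~ w) z) Hz.
Qed.

End Bellman.

Theorem theorem9 (R : realType) (d : measure_display) (Omega : measurableType d)
    (P : probability Omega R) (T N M : nat) (F : nat -> set (set Omega))
    (K : nat -> 'rV[R]_N * 'rV[R]_M * 'rV[R]_N -> Omega -> \bar R)
    (J : 'rV[R]_N -> Omega -> \bar R)
    (Jt : nat -> 'rV[R]_N -> Omega -> \bar R)
    (Q EQ : nat -> 'rV[R]_N * 'rV[R]_M -> Omega -> \bar R)
    (hF : filtration_upto F T)
    (hF0 : forall A, F 0%N A -> P A = 0%E \/ P A = 1%E)
    (hK : forall t, (1 <= t <= T)%N -> lb_convex_normal_integrand P (F t) (K t))
    (hJ : lb_convex_normal_integrand P (F T) J)
    (hEQ : forall t, (t < T)%N -> is_cond_integrand P (F t) (Q t) (EQ t))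
    (hB : reduced_bellman_solution P K T J Jt Q EQ) :
  (forall s, (s <= T)%N ->
     optimum_value P F K T J = optimum_value P F K s (Jt s)) /\
  (forall (X : nat -> Omega -> 'rV[R]_N) (U : nat -> Omega -> 'rV[R]_M),
     adapted F T (X, U) ->
     (is_solution P F K T J (X, U) <->
      {ae P, forall w,
        argmin (Jt 0%N ^~ w) (X 0%N w) /\
        (forall t, (t < T)%N ->
           argmin (fun u => EQ t (X t w, u) w) (U t w) /\
           argmin (fun y => (K t.+1 (X t w, U t w, y) w + Jt t.+1 y w)%E)
             (X t.+1 w))})).

Proof.
have opt s : (s <= T)%N -> optimum_value P F K T J = optimum_value P F K s (Jt s).
  exact: (optimum_valueE hF hK hJ hEQ hB).
split=> // X U aXU; split.
  move=> [_ costopt optoo].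
  rewrite (cost_terminal hF hK hJ hB aXU) in costopt.
  have aXUs s (sT : (s <= T)%N) := adapted_le sT aXU.
  (* The truncated costs increase to the optimal cost at [T], and each is at least the optimum of
     its own truncated problem, which is the same number; so all of them coincide. *)
  have csE s (sT : (s <= T)%N) :
      cost P K s (Jt s) (X, U) = optimum_value P F K T J.
    apply/le_anti; rewrite -{1}costopt (cost_mono hF hK hEQ hB)//= ?sT ?leqnn//.
    rewrite (opt s sT); apply: ereal_inf_lbound; exists (X, U) => //; exact: aXUs.
  have h0 := @value0_minimal _ _ _ P T N M F K J Jt Q EQ hF hJ hEQ hB
    (X, U) (aXUs 0%N (leq0n T)).
  have hs : {ae P, forall w, forall t, (t < T)%N ->
      argmin (fun u => EQ t (X t w, u) w) (U t w) /\
      argmin (fun y => (K t.+1 (X t w, U t w, y) w + Jt t.+1 y w)%E) (X t.+1 w)}.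
    apply: ae_foralln => t /=; have [tT|tT] := ltnP t T; last first.
      by apply: aeW => w.
    have := solution_step hF hK hEQ hB tT (aXUs _ tT) optoo (csE t (ltnW tT)) (csE _ tT).
    by apply: filterS => w hw _.
  apply: filterS2 (h0 _ _) hs => //.
  - by rewrite (csE 0%N)// -opt.
  - by rewrite (csE 0%N).
move=> opt_ae.
have aXUs s (sT : (s <= T)%N) := adapted_le sT aXU.
(* Minimality of X_0 makes the cost at time 0 the integral of inf J_0, which is a lower bound for
   the time-0 cost of every adapted competitor. *)
have c0 : cost P K 0 (Jt 0%N) (X, U) = (\int[P]_w inf_value0 Jt w)%E.
  rewrite cost0E; apply: ae_eq_integralT.
  - by have [] := value_quasi hF hB (leq0n T) (adapted_state (leqnn 0%N) (aXUs 0%N (leq0n T))).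
  - by have [] := inf_value0_quasi hB.
  - by apply: filterS opt_ae => w [[-> _] _].
have c0le XU : adapted F 0 XU ->
    (\int[P]_w inf_value0 Jt w <= cost P K 0 (Jt 0%N) XU)%E.
  move=> aXU'; rewrite cost0E; apply: (le_quasi_integral (inf_value0_quasi hB)).
    by have [] := value_quasi hF hB (leq0n T) (adapted_state (leqnn 0%N) aXU').
  by apply: aeW => w; exact: (@ereal_inf_lb_range _ _ (Jt 0%N ^~ w)).
have ctle t : (t <= T)%N -> (cost P K t (Jt t) (X, U) <= cost P K 0 (Jt 0%N) (X, U))%E.
  elim: t => // t IH tT; apply: le_trans (IH (ltnW tT)).
  apply: (argmin_step hF hK hEQ hB tT (aXUs _ tT)).
  by apply: filterS opt_ae => w [_ /(_ t tT)].
have copt : cost P K T J (X, U) = optimum_value P F K T J.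
  apply/le_anti/andP; split; last by apply: ereal_inf_lbound; exists (X, U).
  rewrite (cost_terminal hF hK hJ hB aXU) (opt 0%N)//.
  apply: le_trans (ctle T (leqnn T)) _; rewrite c0.
  by apply: le_ereal_inf_tmp => _ [XU aXU' <-]; exact: c0le.
split=> //; rewrite -copt (cost_terminal hF hK hJ hB aXU).
apply: le_lt_trans (ctle T (leqnn T)) _; rewrite c0.
have [n infn] : exists n : nat, {ae P, forall w, (inf_value0 Jt w <= n%:R%:E)%E}.
  apply: (inf_value0_bounded hF hJ hEQ hB) => //.
    by case: hF => /(_ 0%N (leq0n T)).
  by apply: filterS opt_ae => w [[JE Joo] _]; rewrite /inf_value0 -JE.
apply: (@le_lt_trans _ _ (\int[P]_w n%:R%:E)%E).
  exact: (le_quasi_integral (inf_value0_quasi hB)).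
by rewrite (integral_cst P measurableT)/= probability_setT mule1 ltry.
Qed.
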